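(* Let $P_0=\begin{pmatrix} q & s\\ s & r\end{pmatrix}\in\mathbb{S}^2$ with $r\le 0$, let $$\mathbf{V}=\left\{vI_k \;\middle|\; v\in\mathbb{C},\ \begin{pmatrix}1\\ v\end{pmatrix}^{*}P_0\begin{pmatrix}1\\ v\end{pmatrix}\ge 0\right\},$$ and suppose that $\psi\in \mathrm{RH}_\infty^{m_\psi\times k}$ has the realization $(A_\psi,B_\psi,C_\psi,D_\psi)$ where $A_\psi\in\mathbb{R}^{n_\psi\times n_\psi}$ is Hurwitz. If $$\begin{pmatrix} I&0\\ A_\psi&B_\psi\end{pmatrix}^T\begin{pmatrix}0&Y\\ Y&0\end{pmatrix}\begin{pmatrix} I&0\\ A_\psi&B_\psi\end{pmatrix}+\begin{pmatrix}C_\psi&D_\psi\end{pmatrix}^TM\begin{pmatrix}C_\psi&D_\psi\end{pmatrix}\succ0$$ holds for some $Y\in\mathbb{S}^{n_\psi}$ and $M\in\mathbb{S}^{m_\psi}$, then any $\Delta\in\mathbf{\Delta}(\mathbf{V})$ satisfies a finite-horizon IQC with terminal cost matrix $P_0\otimes Y$ for the multiplier $\Pi=\Psi^{*}(P_0\otimes M)\Psi$, where $\Psi:=\mathrm{diag}(\psi,\psi)$.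
   Context: $\mathbb{S}^n$ is the set of real symmetric $n\times n$ matrices; $\mathrm{RH}_\infty^{m\times n}$ is the space of real rational $m\times n$ matrices without poles in the extended closed right half-plane; $\otimes$ is the Kronecker product; $L_{2e}^n$ is the space of locally square integrable functions $[0,\infty)\to\mathbb{R}^n$. For a real rational $G$, $G^{*}(s)=G(-s)^T$; for a complex matrix, ${}^*$ is the conjugate transpose. Uncertainties: $\Delta$ is a stable LTI system with input-output map $\Delta:L_{2e}^k\to L_{2e}^l$ (here $l=k$), $$\Delta(z)(t)=\int_0^tC_\Delta e^{A_\Delta(t-s)}B_\Delta z(s)\,ds+D_\Delta z(t),$$ for some real matrices $A_\Delta,B_\Delta,C_\Delta,D_\Delta$. The same symbol denotes its transfer matrix $\Delta(s)=C_\Delta(sI-A_\Delta)^{-1}B_\Delta+D_\Delta$; stability means $\Delta\in\mathrm{RH}_\infty^{l\times k}$. For $\mathbf{V}\subset\mathbb{C}^{l\times k}$, $\mathbf{\Delta}(\mathbf{V})$ is the set of all such $\Delta$ with $\Delta(i\omega)\in\mathbf{V}$ for all $\omega\in\mathbb{R}\cup\{\infty\}$. Finite-horizon IQC: let $\Psi\in\mathrm{RH}_\infty^{m\times(k+l)}$ be realized by the filter $\dot\xi=A_\Psi\xi+B_\Psi u$, $y=C_\Psi\xi+D_\Psi u$, $\xi(0)=0$, and let $P\in\mathbb{S}^m$. $\Delta$ satisfies a finite-horizon IQC with terminal cost matrix $Z=Z^T$ for the multiplier $\Pi=\Psi^*P\Psi$ if $$\int_0^Ty(t)^TPy(t)\,dt+\xi(T)^TZ\xi(T)\ge0\quad\text{for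 all }T\ge0$$ holds for the trajectories of the filter driven by $u=\begin{pmatrix}z\\ \Delta(z)\end{pmatrix}$ with any $z\in L_{2e}^k$. For $\Psi=\mathrm{diag}(\psi,\psi)$ the realization used is $J_\Psi=\mathrm{diag}(J_\psi,J_\psi)$ for $J\in\{A,B,C,D\}$. *)

(* Defs.v *)
From HB Require Import structures.
From mathcomp Require Import all_boot all_order all_algebra.
From mathcomp Require Import sesquilinear spectral.
From mathcomp Require Import complex mxtens.
From mathcomp Require Import all_classical all_reals all_analysis.

Set Implicit Arguments.
Unset Strict Implicit.
Unset Printing Implicit Defensive.

Import Order.TTheory GRing.Theory Num.Theory.
Import numFieldNormedType.Exports.

Local Open Scope classical_set_scope.
Local Open Scope complex_scope.
Local Open Scope sesquilinear_scope.
Local Open Scope ring_scope.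
Local Open Scope quotient_scope.

Local Notation "x %:F" := (tofrac x).

Section RationalMatrices.
Variable R : realType.

(* Real rational functions of s are the elements of {fraction {poly R}}.
   rnum f / rden f is f in lowest terms (unique up to a common constant), so
   that the roots of rden f are exactly the finite poles of f. *)
Definition rnum (f : {fraction {poly R}}) : {poly R} :=
  let: (p, q) := frac (repr f) in p %/ gcdp p q.
Definition rden (f : {fraction {poly R}}) : {poly R} :=
  let: (p, q) := frac (repr f) in q %/ gcdp p q.

Definition pole (f : {fraction {poly R}}) (z : R[i]) : Prop :=
  root (map_poly (real_complex R) (rden f)) z.

Definition pole_oo (f : {fraction {poly R}}) : Prop :=
  (size (rden f) < size (rnum f))%N.

Definition reval (f : {fraction {poly R}}) (z : R[i]) : R[i] :=
  (map_poly (real_complex R) (rnum f)).[z]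
  / (map_poly (real_complex R) (rden f)).[z].

(* The limit of f(s) as |s| tends to infinity, meaningful if f has no pole
   there. *)
Definition reval_oo (f : {fraction {poly R}}) : R :=
  (rnum f)`_(size (rden f)).-1 / lead_coef (rden f).

Definition RHinf m n (G : 'M[{fraction {poly R}}]_(m, n)) : Prop :=
  forall i j, ~ pole_oo (G i j) /\
    forall z : R[i], 0 <= complex.Re z -> ~ pole (G i j) z.

(* G(i w) for w in R \cup {oo}; None stands for w = oo. *)
Definition freq_resp m n (G : 'M[{fraction {poly R}}]_(m, n)) (w : option R) :
    'M[R[i]]_(m, n) :=
  match w with
  | Some w => map_mx (fun f => reval f (0 +i* w)) G
  | None => map_mx (fun f => (reval_oo f)%:C) G
  end.

(* G^*(s) = G(-s)^T *)
Definition para_conj m n (G : 'M[{fraction {poly R}}]_(m, n)) :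
    'M[{fraction {poly R}}]_(n, m) :=
  map_mx (fun f => (rnum f \Po (- 'X))%:F / (rden f \Po (- 'X))%:F) G^T.

Definition const_rmx m n (A : 'M[R]_(m, n)) : 'M[{fraction {poly R}}]_(m, n) :=
  map_mx (fun a => a%:P%:F) A.

End RationalMatrices.

Section Matrices.
Variable R : realType.

Definition hurwitz n (A : 'M[R]_n) : Prop :=
  forall z : R[i],
    eigenvalue (map_mx (real_complex R) A) z -> complex.Re z < 0.

Definition posdefmx n (M : 'M[R]_n) : Prop :=
  M \is symmetricmx /\
  forall x : 'cV[R]_n, x != 0 -> 0 < (x^T *m M *m x) 0 0.

Definition expmx n (A : 'M[R]_n) : 'M[R]_n :=
  \matrix_(i, j) limn (series (fun p => (A ^+ p) i j / p`!%:R)).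

Lemma mul2n_addn m : (2 * m = m + m)%N.
Proof. by rewrite mul2n addnn. Qed.

(* P \otimes M for a 2 x 2 matrix P, with dimensions cast from 2 * m to m + m
   so that it matches 2 x 2 block matrices. *)
Definition kron2 m n (P : 'M[R]_2) (M : 'M[R]_(m, n)) : 'M[R]_(m + m, n + n) :=
  castmx (mul2n_addn m, mul2n_addn n) (P *t M).

Definition mx22 (q s r : R) : 'M[R]_2 :=
  \matrix_(i, j) if (i == 0) && (j == 0) then q
                 else if (i == 0) || (j == 0) then s else r.

Definition diag2 (K : pzRingType) m n (X : 'M[K]_(m, n)) : 'M[K]_(m + m, n + n) :=
  block_mx X 0 0 X.

(* {v I_k | (1; v)^* P0 (1; v) >= 0}; on R[i], 0 <= x means that x is real and
   nonnegative. *)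
Definition Vset (P0 : 'M[R]_2) k : set 'M[R[i]]_k :=
  [set v%:M | v in [set v : R[i] |
     let e : 'cV[R[i]]_2 := @col_mx _ 1 1 1 1%:M v%:M in
     0 <= (e^t* *m map_mx (real_complex R) P0 *m e) 0 0]].

End Matrices.

Arguments Vset {R} P0 k _.

Section Systems.
Variable R : realType.

(* State-space data with n states, k inputs and l outputs. *)
Record lti (n k l : nat) := Lti {
  ltiA : 'M[R]_n; ltiB : 'M[R]_(n, k);
  ltiC : 'M[R]_(l, n); ltiD : 'M[R]_(l, k) }.

Definition transfer n k l (S : lti n k l) : 'M[{fraction {poly R}}]_(l, k) :=
  const_rmx (ltiC S) *m invmx ('X%:F%:M - const_rmx (ltiA S))
    *m const_rmx (ltiB S) + const_rmx (ltiD S).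

Definition lti_diag2 n k l (S : lti n k l) : lti (n + n) (k + k) (l + l) :=
  Lti (diag2 (ltiA S)) (diag2 (ltiB S)) (diag2 (ltiC S)) (diag2 (ltiD S)).

(* Signals [0, oo) -> R^n are total functions on R; only their values at
   nonnegative times are ever used. *)
Definition L2e n (z : R -> 'cV[R]_n) : Prop :=
  (forall i, measurable_fun (`[0, +oo[ : set R) (fun t : R => z t i 0)) /\
  forall T : R, 0 <= T ->
    (@lebesgue_measure R).-integrable `[0, T]
      (fun t => (((z t)^T *m z t) 0 0)%:E).

Definition vint n (T : R) (f : R -> 'cV[R]_n) : 'cV[R]_n :=
  \col_i \int[@lebesgue_measure R]_(t in `[0, T]) (f t i 0).

Definition io_map n k l (S : lti n k l) (z : R -> 'cV[R]_k) (t : R) : 'cV[R]_l :=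
  vint t (fun s => ltiC S *m expmx ((t - s) *: ltiA S) *m ltiB S *m z s)
  + ltiD S *m z t.

Definition Deltas n k l (V : set 'M[R[i]]_(l, k)) : set (lti n k l) :=
  [set Delta | RHinf (transfer Delta) /\
               forall w : option R, V (freq_resp (transfer Delta) w)].

(* xi is the (Caratheodory) solution on [0, oo) of xi' = A xi + B u, xi(0) = 0. *)
Definition filter_state n k l (S : lti n k l) (u : R -> 'cV[R]_k)
    (xi : R -> 'cV[R]_n) : Prop :=
  (forall i, {within `[0, +oo[, continuous (fun t => xi t i 0)}) /\
  forall t : R, 0 <= t ->
    xi t = vint t (fun s => ltiA S *m xi s + ltiB S *m u s).

(* Delta satisfies a finite-horizon IQC with terminal cost matrix Z for the
   multiplier Pi = Psi^* P Psi, where J is the realization of Psi in use. *)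
Definition finite_horizon_IQC nD k l (Delta : lti nD k l)
    n m (J : lti n (k + l) m) (Psi : 'M[{fraction {poly R}}]_(m, k + l))
    (P : 'M[R]_m) (Z : 'M[R]_n) (Pi : 'M[{fraction {poly R}}]_(k + l)) : Prop :=
  [/\ RHinf Psi /\ Psi = transfer J,
      P \is symmetricmx, Z \is symmetricmx,
      Pi = para_conj Psi *m const_rmx P *m Psi &
      forall z : R -> 'cV[R]_k, L2e z ->
      let u t := col_mx (z t) (io_map Delta z t) in
      forall xi : R -> 'cV[R]_n, filter_state J u xi ->
      let y t := ltiC J *m xi t + ltiD J *m u t in
      forall T : R, 0 <= T ->
        0 <= \int[@lebesgue_measure R]_(t in `[0, T]) (((y t)^T *m P *m y t) 0 0)
             + ((xi T)^T *m Z *m xi T) 0 0].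

End Systems.

(* Main.v *)
Require Import Defs.
From HB Require Import structures.
From mathcomp Require Import all_boot all_order all_algebra.
From mathcomp Require Import sesquilinear spectral.
From mathcomp Require Import complex mxtens polyrcf.
From mathcomp Require Import all_classical all_reals all_analysis.
From mathcomp Require Import measurable_realfun.
From mathcomp Require Import ring lra zify.

Set Implicit Arguments.
Unset Strict Implicit.
Unset Printing Implicit Defensive.

Import Order.TTheory GRing.Theory Num.Theory.
Import numFieldNormedType.Exports.

Local Open Scope classical_set_scope.
Local Open Scope ring_scope.

(** On the imaginary axis an admissible Delta is a multiple of the identity, so
    it is one as a rational matrix: Delta = delta I with delta = n / d, where d
    is monic and all its roots lie in the open left half-plane.  Writing
    p~(x) = p(-x), the constraint says that
      E = q d d~ + s (d n~ + n d~) + r n n~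
    is nonnegative on the imaginary axis.

    A storage function for delta.  As E restricted to the axis is a nonnegative
    real polynomial, it is a sum of two squares there, and this descends to
    E = h1 h1~ + h2 h2~ with real h1, h2 (spectral_factorization).  Hence the
    polynomial
      q d(x) d(y) + s (d(x) n(y) + n(x) d(y)) + r n(x) n(y)
        - h1(x) h1(y) - h2(x) h2(y)
    vanishes for y = -x and equals (x + y) S(x, y)
    (divide_by_sum_of_variables).  In the companion realization of delta the
    factor x + y is a time derivative, so that along every trajectory with
    state X, input f and output g,
      q f^2 + 2 s f g + r g^2 = (X^T S X)' + a sum of squares.
    For f = 0 and r <= 0 this is a Lyapunov inequality; the companion matrix is
    Hurwitz, so S is positive semidefinite (lyapunov_ge0).  The same holds for
    row-valued signals weighted by any positive semidefinite Q, with
    \tr (S X Q X^T) in place of X^T S X (storage_function).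

    Where the terminal cost comes from.  A scalar system commutes with every
    linear filter: if the state x1 of psi belongs to the input z, the state x2
    that belongs to w = Delta z is the response of delta to x1
    (filters_commute).  Thus f2 = (x2, w) is the response of delta to
    f1 = (x1, z).  With Q the matrix of the linear matrix inequality, the
    integrand plus the derivative of the terminal cost xi^T (P0 \otimes Y) xi is
      q f1^T Q f1 + s (f1^T Q f2 + f2^T Q f1) + r f2^T Q f2
    (supply_form).  By the storage function for delta this is at least the
    derivative of \tr (S X Q X^T), which starts at 0 and ends nonnegative;
    integrating over [0, T] gives the inequality.

    The given realization of Delta enters only through its impulse response,
    which is that of the companion realization because transfer functions
    determine Markov parameters (markov_unique).  Trajectories are absolutely
    continuous, so derivatives are used in integrated form, with a product rule
    obtained from Fubini's theorem (primitiveM). *)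

Local Notation toC R := (real_complex R).
Local Notation polyC_ f := (map_poly (real_complex _) f).
Local Notation "x %:F" := (tofrac x).

(** * Polynomials nonnegative on the imaginary axis *)
Section SumOfSquares.
Variable R : realType.
Implicit Types (p : {poly R}) (w : R).

Lemma poly_eq0_of_inj_roots (F : idomainType) (p : {poly F}) (g : nat -> F) :
  injective g -> (forall n, p.[g n] = 0) -> p = 0.
Proof.
move=> g_inj pg; apply/eqP/negPn/negP => p0.
have := @max_poly_roots _ p (map g (iota 0 (size p))) p0.
rewrite size_map size_iota ltnn => h; apply: notF; apply: h.
  by apply/allP => _ /mapP[n _ ->]; apply/rootP.
by rewrite map_inj_uniq // iota_uniq.
Qed.

Lemma poly_ge0_right p z : (forall x, z < x -> 0 <= p.[x]) -> 0 <= p.[z].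
Proof.
move=> p_ge0; rewrite leNgt; apply/negP => pz.
have [|d d0 /(_ (z + d / 2))] := @poly_cont R z p (- p.[z]); first by rewrite oppr_gt0.
have -> : z + d / 2 - z = d / 2 by ring.
rewrite gtr0_norm; last by lra.
move=> /(_ ltac:(lra)); have := p_ge0 (z + d / 2) ltac:(lra).
by rewrite ltr_norml => + /andP[_]; lra.
Qed.

(** A nonnegative polynomial has no simple real root: the cofactor of X - x is
    nonnegative to the right of x and nonpositive to its left. *)
Lemma poly_ge0_root p x : (forall y, 0 <= (('X - x%:P) * p).[y]) -> p.[x] = 0.
Proof.
move=> h; apply/eqP; rewrite eq_le; apply/andP; split; last first.
  apply: poly_ge0_right => y xy; have := h y.
  by rewrite hornerM hornerXsubC pmulr_rge0 // subr_gt0.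
have : 0 <= (- (p \Po - 'X)).[- x].
  apply: poly_ge0_right => y xy; have := h (- y).
  rewrite hornerM hornerXsubC hornerN horner_comp hornerN hornerX.
  by rewrite nmulr_rge0 ?oppr_ge0 //; lra.
by rewrite hornerN horner_comp hornerN hornerX opprK oppr_ge0.
Qed.

Lemma horner_toC p (x : R) : (polyC_ p).[(x)%:C%C] = (p.[x])%:C%C.
Proof. by rewrite horner_map. Qed.

Lemma toC_mulI (u v x y : R) :
  (u%:C * Complex x y + v%:C)%C = Complex (u * x + v) (u * y).
Proof. by apply/eqP; rewrite eq_complex /=; apply/andP; split; apply/eqP; ring. Qed.

(** The quadratic factor comes from a complex root x + i y.  The case y = 0
    stands for a real root, which is a double one. *)
Lemma nonneg_poly_factor p : (forall x, 0 <= p.[x]) -> (1 < size p)%N ->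
  exists x y g, p = (('X - x%:P) ^+ 2 + (y ^+ 2)%:P) * g.
Proof.
move=> p_ge0 sp.
have [[x y] /rootP pz] : {z | root (polyC_ p) z}.
  by apply/sigW/closed_rootP; rewrite size_map_poly neq_ltn sp orbT.
have [y0|y0] := eqVneq y 0.
  move: pz; rewrite y0 horner_toC => -[/rootP/factor_theorem[g pE]].
  have gx : g.[x] = 0.
    by apply: poly_ge0_root => t; rewrite mulrC -pE.
  have /factor_theorem[g' gE] : root g x by apply/rootP.
  exists x, 0, g'; rewrite pE gE expr0n addr0; ring.
set q := ('X - x%:P) ^+ 2 + (y ^+ 2)%:P.
have sq : size q = 3%N.
  rewrite /q size_polyDl ?size_polyC; first by rewrite size_exp_XsubC.
  by rewrite size_exp_XsubC; case: (_ != _).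
have q0 : q != 0 by rewrite -size_poly_eq0 sq.
have qz : (polyC_ q).[Complex x y] = 0.
  rewrite rmorphD rmorphXn rmorphB /= map_polyX !map_polyC /= hornerE !horner_exp.
  rewrite !hornerE /=; apply/eqP; rewrite eq_complex /=; apply/andP.
  by split; apply/eqP; rewrite /=; ring.
exists x, y, (p %/ q); rewrite mulrC.
suff r0 : p %% q = 0 by rewrite {1}(divp_eq p q) r0 addr0.
have sr : (size (p %% q)%R <= 2)%N by rewrite -ltnS -sq ltn_modp.
have rE : p %% q = (p %% q)`_1 *: 'X + ((p %% q)`_0)%:P.
  apply/polyP => -[|[|n]]; rewrite coefD coefZ coefX coefC /= ?(mulr1, mulr0, addr0, add0r) //.
  by rewrite nth_default // (leq_trans sr).
have : (polyC_ (p %/ q * q + p %% q)).[Complex x y] = 0 by rewrite -divp_eq.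
rewrite rmorphD rmorphM /= hornerD hornerM qz mulr0 add0r {1}rE.
rewrite rmorphD /= map_polyZ /= map_polyX map_polyC hornerD hornerZ hornerX hornerC /=.
rewrite toC_mulI; case => uxv /eqP; rewrite mulf_eq0 (negPf y0) orbF => /eqP u0.
by rewrite u0 mul0r add0r in uxv; rewrite rE u0 uxv scale0r addr0.
Qed.

(** Induction on the degree.  The factor of nonneg_poly_factor is itself a sum
    of two squares, and the product of two such sums is one again by the
    Brahmagupta identity.  The size bounds let a and b keep half the degree of
    p, as needed for jets of the order of the denominator. *)
Lemma nonneg_poly_sum_sqr p : (forall x, 0 <= p.[x]) ->
  exists a b, [/\ p = a ^+ 2 + b ^+ 2, ((size a).*2 <= (size p).+1)%N
                & ((size b).*2 <= (size p).+1)%N].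
Proof.
have [n] := ubnP (size p); elim: n p => // n IH p; rewrite ltnS => pn p_ge0.
have [sp|sp] := leqP (size p) 1.
  have pE := size1_polyC sp.
  have c0 : 0 <= p`_0 by have := p_ge0 0; rewrite pE hornerC coefC.
  exists ((Num.sqrt p`_0)%:P), 0; rewrite size_poly0; split => //.
    by rewrite expr0n addr0 -rmorphXn /= sqr_sqrtr.
  rewrite {2}pE !size_polyC; have [->|_] := eqVneq p`_0 0; first by rewrite sqrtr0 eqxx.
  by case: (_ != _).
have [x [y [g pE]]] := nonneg_poly_factor p_ge0 sp.
set q := (_ + _) in pE.
have sq : size q = 3%N.
  rewrite /q size_polyDl ?size_polyC; first by rewrite size_exp_XsubC.
  by rewrite size_exp_XsubC; case: (_ != _).
have p0 : p != 0 by rewrite -size_poly_gt0 ltnW.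
have [q0 g0] : q != 0 /\ g != 0.
  by split; apply: contraNneq p0 => e; rewrite pE e ?mul0r ?mulr0.
have spE : size p = (size g).+2 by rewrite pE size_mul // sq addSn /= addSn.
have qE t : q.[t] = (t - x) ^+ 2 + y ^+ 2 by rewrite !(hornerE, horner_exp).
have g_gt t : t != x -> 0 <= g.[t].
  move=> tx; have := p_ge0 t; rewrite pE hornerM pmulr_rge0 // qE.
  by rewrite ltr_wpDr ?sqr_ge0 // exprn_even_gt0 //= subr_eq0.
have g_ge0 t : 0 <= g.[t].
  have [->|/g_gt//] := eqVneq t x.
  by apply: poly_ge0_right => u; rewrite lt_neqAle eq_sym => /andP[/g_gt].
have [|a [b [gE sa sb]]] := IH g _ g_ge0; first by rewrite spE in pn; apply: leq_trans pn.
have sX (u : {poly R}) : (size (('X - x%:P) * u)%R <= (size u).+1)%N.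
  have [->|u0] := eqVneq u 0; first by rewrite mulr0 size_poly0.
  by rewrite size_mul ?polyXsubC_eq0 // size_XsubC.
have sy (u : {poly R}) : (size (y%:P * u)%R <= (size u).+1)%N.
  by rewrite mul_polyC (leq_trans (size_scale_leq _ _)).
have bnd (u v w : {poly R}) : ((size u).*2 <= (size g).+1)%N ->
    ((size v).*2 <= (size g).+1)%N -> (size w <= maxn (size u).+1 (size v).+1)%N ->
    ((size w).*2 <= (size p).+1)%N.
  move=> su sv hw; rewrite spE.
  have : ((size w).*2 <= (maxn (size u).+1 (size v).+1).*2)%N by rewrite leq_double.
  move/leq_trans; apply; rewrite /maxn.
  by case: ifP => _; rewrite doubleS !ltnS.
exists (('X - x%:P) * a - y%:P * b), (('X - x%:P) * b + y%:P * a); split.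
- rewrite pE gE /q polyC_exp; ring.
- apply: (bnd a b _ sa sb); apply: leq_trans (size_polyD _ _) _.
  by rewrite size_polyN geq_max !leq_max sX sy orbT.
- apply: (bnd b a _ sb sa); apply: leq_trans (size_polyD _ _) _.
  by rewrite geq_max !leq_max sX sy orbT.
Qed.

Lemma complex_poly_parts (g : {poly R[i]}) : exists u v : {poly R},
  [/\ (size u <= size g)%N, (size v <= size g)%N
    & g = polyC_ u + 'i%C *: polyC_ v].
Proof.
exists (\poly_(j < size g) complex.Re g`_j), (\poly_(j < size g) complex.Im g`_j).
split; rewrite ?size_poly //; apply/polyP => j.
by rewrite coefD coefZ !coef_map /= -complexE.
Qed.

Lemma horner_polyC_conj (f : {poly R}) (z : R[i]) :
  (polyC_ f).[(z^*)%C] = ((polyC_ f).[z]^*)%C.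
Proof.
rewrite -[RHS]horner_map -map_poly_comp; congr (_.[_]).
by apply: eq_map_poly => x /=; rewrite oppr0.
Qed.

Lemma conj_im w : ((0 +i* w)^*)%C = (0 +i* (- w))%C.
Proof. by []. Qed.

Lemma poly_eq_on_imaginary_axis (f g : {poly R}) :
  (forall w, (polyC_ f).[(0 +i* w)%C] = (polyC_ g).[(0 +i* w)%C]) -> f = g.
Proof.
move=> fg; apply/eqP; rewrite -subr_eq0; apply/eqP.
apply: (map_inj_poly (@complexI R) (rmorph0 _)); rewrite rmorph0.
apply: (@poly_eq0_of_inj_roots _ _ (fun n => (0 +i* (n%:R : R))%C)).
  by move=> m n [] /eqP; rewrite eqr_nat => /eqP.
by move=> n; rewrite rmorphB hornerD hornerN fg subrr.
Qed.

(** For real w, E(i w) = u(w) with u real and nonnegative, so u = a^2 + b^2 =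
    |a + i b|^2.  Substituting w = - i x in a + i b and splitting coefficients
    into real and imaginary parts gives h = h1 + i h2 with E = |h|^2 on the axis.
    The cross term between h1 and h2 is odd in w while E(i w) is even, so that
    averaging over w and - w leaves |h1|^2 + |h2|^2. *)
Lemma spectral_factorization (E : {poly R}) :
  (forall w, 0 <= (polyC_ E).[(0 +i* w)%C]) ->
  exists h1 h2, [/\ E = h1 * (h1 \Po - 'X) + h2 * (h2 \Po - 'X),
    ((size h1).*2 <= (size E).+1)%N & ((size h2).*2 <= (size E).+1)%N].
Proof.
move=> E_ge0.
have [u [v [su sv PE]]] := complex_poly_parts (polyC_ E \Po ('i%C *: 'X)).
have sP : (size (polyC_ E \Po ('i%C *: 'X : {poly R[i]})) <= size E)%N.
  rewrite -(size_map_poly (toC R) E) size_comp_poly2 //.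
  by rewrite size_scale ?size_polyX // eq_complex /= oner_eq0 andbF.
have Ew w : (polyC_ E).[(0 +i* w)%C] = (u.[w] +i* v.[w])%C.
  have -> : (0 +i* w)%C = ('i%C *: 'X).[w%:C%C].
    rewrite hornerZ hornerX; apply/eqP; rewrite eq_complex /=.
    by apply/andP; split; apply/eqP; ring.
  rewrite -horner_comp PE hornerD hornerZ !horner_toC.
  by apply/eqP; rewrite eq_complex /=; apply/andP; split; apply/eqP; ring.
have u_ge0 w : 0 <= u.[w] by have := E_ge0 w; rewrite Ew lecE /= => /andP[].
have v0 w : v.[w] = 0 by have := E_ge0 w; rewrite Ew lecE /= => /andP[/eqP].
have [a [b [uE sa sb]]] := nonneg_poly_sum_sqr u_ge0.
set h := (polyC_ a + 'i%C *: polyC_ b) \Po ((- 'i%C) *: 'X).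
have [h1 [h2 [s1 s2 hE]]] := complex_poly_parts h.
have sh : ((size h).*2 <= (size E).+1)%N.
  rewrite size_comp_poly2; last first.
    by rewrite size_scale ?size_polyX // oppr_eq0 eq_complex /= oner_eq0 andbF.
  have m : ((maxn (size a) (size b)).*2 <= (size E).+1)%N.
    rewrite /maxn; case: ifP => _.
      by rewrite (leq_trans sb) // ltnS (leq_trans su).
    by rewrite (leq_trans sa) // ltnS (leq_trans su).
  apply: leq_trans m; rewrite leq_double (leq_trans (size_polyD _ _)) //.
  rewrite size_map_poly geq_max leq_maxl /= (leq_trans (size_scale_leq _ _)) //.
  by rewrite size_map_poly leq_maxr.
exists h1, h2; split; last 2 first.
- by apply: leq_trans sh; rewrite leq_double.
- by apply: leq_trans sh; rewrite leq_double.
have key w : (a.[w] +i* b.[w])%C = (polyC_ h1).[(0 +i* w)%C] + 'i%C * (polyC_ h2).[(0 +i* w)%C].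
  have -> : (a.[w] +i* b.[w])%C = h.[(0 +i* w)%C].
    rewrite /h horner_comp hornerZ hornerX.
    have -> : - 'i%C * (0 +i* w)%C = w%:C%C.
      by apply/eqP; rewrite eq_complex /=; apply/andP; split; apply/eqP; ring.
    rewrite hornerD hornerZ !horner_toC.
    by apply/eqP; rewrite eq_complex /=; apply/andP; split; apply/eqP; ring.
  by rewrite hE hornerD hornerZ.
apply: poly_eq_on_imaginary_axis => w.
have Em : (polyC_ E).[(0 +i* (- w))%C] = (polyC_ E).[(0 +i* w)%C].
  by rewrite -conj_im horner_polyC_conj Ew v0 /= oppr0.
have := key w; have := key (- w); rewrite -!conj_im !horner_polyC_conj.
move: Em; rewrite !Ew !v0 => -[Em].
rewrite rmorphD !rmorphM /= !map_comp_poly !rmorphN /= map_polyX hornerD !hornerM !horner_comp hornerN hornerX.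
have -> : - (0 +i* w)%C = ((0 +i* w)^*)%C.
  by apply/eqP; rewrite eq_complex /=; apply/andP; split; apply/eqP; ring.
rewrite !horner_polyC_conj.
case: (polyC_ h1).[_] => a1 a2; case: (polyC_ h2).[_] => b1 b2 /= [am bm] [ap bp].
have um : u.[w] = a.[w] ^+ 2 + b.[w] ^+ 2 by rewrite uE hornerD !horner_exp.
have up : u.[w] = a.[- w] ^+ 2 + b.[- w] ^+ 2 by rewrite -Em uE hornerD !horner_exp.
apply/eqP; rewrite eq_complex /=; apply/andP; split; apply/eqP; last by ring.
(* the average of the identities at w and - w *)
have : u.[w] + u.[w] = 2 * (a1 ^+ 2 + a2 ^+ 2 + b1 ^+ 2 + b2 ^+ 2).
  by rewrite {1}um up am bm ap bp; ring.
by lra.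
Qed.

End SumOfSquares.

(** * Decay of matrix powers *)
Section PowerDecay.

(** Induction on the factors: B A^(p+1) = z (B A^p) + (B (A - z)) A^p, where the
    last term already decays like rho^p and |z| < rho. *)
Lemma pow_bound_of_split (C : numFieldType) n (A B : 'M[C]_n) (rs : seq C) (rho : C) :
  0 < rho -> (forall z, z \in rs -> `|z| < rho) ->
  B *m \prod_(z <- rs) (A - z%:M) = 0 ->
  exists2 K, 0 <= K & forall p i j, `|(B *m A ^+ p) i j| <= K * rho ^+ p.
Proof.
move=> rho0; elim: rs B => [|z rs IH] B rs_lt.
  rewrite big_nil mulmx1 => ->; exists 0 => // p i j.
  by rewrite mul0mx mxE normr0 mul0r.
rewrite big_cons mulmxA => B0.
have z_lt : `|z| < rho by apply: rs_lt; rewrite mem_head.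
have [z' zr'|K K0 hK] := IH (B *m (A - z%:M)) _ B0.
  by apply: rs_lt; rewrite in_cons zr' orbT.
have gap : 0 < rho - `|z| by rewrite subr_gt0.
set b := \sum_i \sum_j `|B i j|.
have b0 : 0 <= b by do 2 (apply: sumr_ge0 => ? _).
(* b bounds B itself, K / (rho - |z|) the response of the recursion to its
   forcing term *)
exists (b + K / (rho - `|z|)); first by rewrite addr_ge0 // divr_ge0 // ltW.
elim=> [|p IHp] i j.
  rewrite expr0 mulmx1 mulr1 ler_wpDr ?divr_ge0 ?(ltW gap) //.
  rewrite /b (bigD1 i) //= (bigD1 j) //= -addrA ler_wpDr // addr_ge0 ?sumr_ge0 //.
  by move=> ? _; apply: sumr_ge0.
have -> : B *m A ^+ p.+1 = (B *m (A - z%:M)) *m A ^+ p + z *: (B *m A ^+ p).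
  rewrite exprS -[A * _]/(A *m _) mulmxA mulmxBr mulmxBl mul_mx_scalar -scalemxAl.
  by rewrite subrK.
rewrite !mxE; apply: le_trans (ler_normD _ _) _; rewrite normrM.
have h1 := hK p i j; have h2 := IHp i j; rewrite !mxE in h1 h2.
apply: le_trans (lerD h1 (ler_wpM2l (normr_ge0 _) h2)) _.
rewrite -subr_ge0; set c := K / _.
have -> : (b + c) * rho ^+ p.+1 - (K * rho ^+ p + `|z| * ((b + c) * rho ^+ p))
  = b * (rho - `|z|) * rho ^+ p.
  by rewrite exprS /c; field; rewrite gt_eqF.
by rewrite !mulr_ge0 // ?exprn_ge0 // ltW.
Qed.

Lemma common_radius (R : realType) (rs : seq R[i]) :
  (forall z, z \in rs -> `|z| < 1) ->
  exists2 rho : R, 0 < rho < 1 & forall z, z \in rs -> `|z| < rho%:C%C.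
Proof.
elim: rs => [_|z rs IH h]; first by exists (1/2) => //; apply/andP; split; lra.
have [z' zr|rho /andP[r0 r1] hr] := IH; first by apply: h; rewrite in_cons zr orbT.
have : `|z| < 1 by apply: h; rewrite mem_head.
rewrite normc_def -[1]/(1%:C%C) ltcR; set m := Num.sqrt _ => m1.
have m0 : 0 <= m by exact: sqrtr_ge0.
exists ((Num.max m rho + 1) / 2).
  by have := le_max rho m rho; rewrite lexx orbT; case: (leP m rho); lra.
move=> z'; rewrite in_cons => /orP[/eqP ->|/hr].
  by rewrite normc_def ltcR -/m; case: (leP m rho); lra.
by move/lt_trans; apply; rewrite ltcR; case: (leP m rho); lra.
Qed.

(** By Cayley-Hamilton the product of the F - z over the eigenvalues z vanishes,
    so pow_bound_of_split applies to the identity matrix. *)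
Lemma mx_pow_cvg0 (R : realType) n (F : 'M[R]_n) :
  (forall z, eigenvalue (map_mx (toC R) F) z -> `|z| < 1) ->
  forall i j, (fun p => (F ^+ p) i j) @ \oo --> (0 : R).
Proof.
case: n F => [|n] F F_lt i j; first by case: i.
have [rs pE] := closed_field_poly_normal (char_poly (map_mx (toC R) F)).
rewrite (monicP (char_poly_monic _)) scale1r in pE.
have [z zr|rho /andP[r0 r1] hr] := @common_radius R rs.
  by apply: F_lt; rewrite eigenvalue_root_char pE root_prod_XsubC.
have CH : 1%:M *m \prod_(z <- rs) (map_mx (toC R) F - z%:M) = 0.
  rewrite mul1mx -(Cayley_Hamilton (map_mx (toC R) F)) pE rmorph_prod /=.
  by apply: eq_bigr => z _; rewrite rmorphB /= horner_mx_X horner_mx_C.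
have [|K K0 hK] := pow_bound_of_split _ hr CH; first by rewrite ltcR.
have KE : K = (complex.Re K)%:C%C by move: K0; case: (K) => a b; rewrite lecE /= => /andP[/eqP -> _].
have bnd p : `|(F ^+ p) i j| <= geometric (complex.Re K) rho p.
  have := hK p i j; rewrite mul1mx -rmorphXn /= mxE KE -rmorphXn -rmorphM /=.
  by rewrite normc_def /= expr0n addr0 sqrtr_sqr lecR.
apply: norm_cvg0; apply: (@squeeze_cvgr _ _ _ _ (fun=> 0) (geometric (complex.Re K) rho)).
- by apply: nearW => p; rewrite normr_ge0 bnd.
- exact: cvg_cst.
- by apply: cvg_geometric; rewrite ger0_norm // ltW.
Qed.

Lemma cvg_sumr (R : realType) (I : finType) (f : I -> nat -> R) (l : I -> R) :
  (forall i, f i @ \oo --> l i) -> (fun k => \sum_i f i k) @ \oo --> \sum_i l i.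
Proof.
by move=> fl; apply: (cvg_big (U := R) (@add_continuous R)).
Qed.

Lemma mx_mul_cvg (R : realType) m n p (X : nat -> 'M[R]_(m, n)) (Y : nat -> 'M[R]_(n, p))
  (A : 'M[R]_(m, n)) (B : 'M[R]_(n, p)) :
  (forall i j, (fun k => X k i j) @ \oo --> (A i j : R)) ->
  (forall i j, (fun k => Y k i j) @ \oo --> (B i j : R)) ->
  forall i j, (fun k => (X k *m Y k) i j) @ \oo --> ((A *m B : 'M[R]_(m, p)) i j : R).
Proof.
move=> XA YB i j; rewrite mxE.
rewrite (_ : (fun k => _) = (fun k => \sum_l X k i l * Y k l j)); last by apply/funext => k; rewrite mxE.
by apply: cvg_sumr => l; apply: cvgM.
Qed.

End PowerDecay.

(** * The Lyapunov inequality *)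
Section Lyapunov.
Variable R : realType.

(** The Cayley transform a |-> (1 + a) / (1 - a) maps the open left half-plane
    onto the open unit disc. *)
Lemma hurwitz_cayley_disc n (A : 'M[R]_n) (z : R[i]) : hurwitz A ->
  eigenvalue (map_mx (toC R) ((1%:M + A) *m invmx (1%:M - A))) z ->
  1%:M - A \in unitmx -> `|z| < 1.
Proof.
move=> hA /eigenvalueP[x xF x0] uA.
have uA' : map_mx (toC R) (1%:M - A) \in unitmx by rewrite map_unitmx.
have xE : x *m (map_mx (toC R) (1%:M + A)) = z *: (x *m map_mx (toC R) (1%:M - A)).
  rewrite scalemxAl -xF -mulmxA -map_mxM -mulmxA mulVmx //.
  by rewrite mulmx1.
rewrite map_mxD map_mxB map_mx1 !mulmxDr mulmxN !mulmx1 scalerBr in xE.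
have xA : (z + 1) *: (x *m map_mx (toC R) A) = (z - 1) *: x.
  move: xE; set t := x *m _ => xE; apply/eqP.
  rewrite scalerDl scalerBl !scale1r eq_sym subr_eq -[z *: x](subrK (z *: t)) -xE.
  by rewrite [x + t]addrC addrAC [t + _]addrC.
have z1 : z + 1 != 0.
  apply: contraNneq x0 => z1; move: xA; rewrite z1 scale0r.
  have -> : z - 1 = - 2%:R by rewrite -[z](addrK 1) z1; ring.
  by move=> /esym /eqP; rewrite scaler_eq0 oppr_eq0 pnatr_eq0.
have : eigenvalue (map_mx (toC R) A) ((z - 1) / (z + 1)).
  apply/eigenvalueP; exists x => //.
  by rewrite mulrC -scalerA -xA scalerA mulVf // scale1r.
move/hA; case: (z) z1 => a b z1.
rewrite normc_def /= => h.
rewrite -[1]/(1%:C%C) ltcR -sqrtr1 ltr_sqrt //.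
have z1' : 0 < (a + 1) ^+ 2 + b ^+ 2.
  rewrite lt_neqAle addr_ge0 ?sqr_ge0 // andbT eq_sym paddr_eq0 ?sqr_ge0 // !sqrf_eq0.
  by move: z1; rewrite eq_complex /= addr0.
move: h; rewrite /= addr0.
have -> : (a - 1) * ((a + 1) / ((a + 1) ^+ 2 + b ^+ 2)) -
    (b - 0) * - (b / ((a + 1) ^+ 2 + b ^+ 2)) = (a ^+ 2 + b ^+ 2 - 1) / ((a + 1) ^+ 2 + b ^+ 2).
  by field; rewrite gt_eqF.
by rewrite pmulr_llt0 ?invr_gt0 // subr_lt0.
Qed.

Lemma hurwitz_one_sub_unit n (A : 'M[R]_n) : hurwitz A -> 1%:M - A \in unitmx.
Proof.
move=> hA; rewrite -(map_unitmx (toC R)) -row_free_unit -kermx_eq0.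
apply: contraTT isT => /rowV0Pn[x /sub_kermxP xA x0].
have := hA 1; rewrite -subr_gt0 /= => h.
suff : (0 : R) < 0 - 1 by rewrite sub0r oppr_gt0 ltr10.
apply: h; apply/eigenvalueP; exists x => //.
by move: xA; rewrite map_mxB map_mx1 mulmxBr mulmx1 scale1r => /eqP; rewrite subr_eq0 => /eqP.
Qed.

(** A discrete version of integrating along exp(t A).  Let V X be the trace to
    be estimated and F the Cayley transform of A.  For X = (1 - A) W the
    difference V (F X) - V X is twice the left-hand side of the hypothesis at W,
    so V decreases along F^k X, which tends to 0, where V vanishes. *)
Lemma lyapunov_ge0 n p (A S : 'M[R]_n) (Q : 'M[R]_p) : hurwitz A ->
  (forall X : 'M[R]_(n, p),
    \tr (S *m (A *m X) *m Q *m X^T) + \tr (S *m X *m Q *m (A *m X)^T) <= 0) ->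
  forall X : 'M[R]_(n, p), 0 <= \tr (S *m X *m Q *m X^T).
Proof.
move=> hA decr X.
have uA := hurwitz_one_sub_unit hA.
set F := (1%:M + A) *m invmx (1%:M - A).
pose B (X Y : 'M[R]_(n, p)) := \tr (S *m X *m Q *m Y^T).
pose V X := B X X.
have BDl X1 X2 Y : B (X1 + X2) Y = B X1 Y + B X2 Y.
  by rewrite /B mulmxDr !mulmxDl raddfD.
have BDr X1 X2 Y : B Y (X1 + X2) = B Y X1 + B Y X2.
  by rewrite /B linearD mulmxDr raddfD.
have BNl X1 Y : B (- X1) Y = - B X1 Y by rewrite /B mulmxN !mulNmx raddfN.
have BNr X1 Y : B Y (- X1) = - B Y X1 by rewrite /B linearN mulmxN raddfN.
have VF Z : V (F *m Z) <= V Z.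
  have [W ->] : exists W, Z = (1%:M - A) *m W.
    by exists (invmx (1%:M - A) *m Z); rewrite mulmxA mulmxV // mul1mx.
  rewrite /F -!mulmxA (mulmxA (invmx _)) mulVmx // mul1mx.
  have := decr W; rewrite -/(B _ _) -/(B _ _) mulmxDl mulmxBl mul1mx /V.
  set Z' := A *m W; rewrite !(BDl, BDr) !(BNl, BNr); lra.
have VFk k : V (F ^+ k *m X) <= V X.
  elim: k => [|k IH]; first by rewrite expr0 mul1mx.
  by rewrite exprS -[F * _]/(F *m _) -mulmxA (le_trans (VF _)).
have Fk i j : (fun k => (F ^+ k) i j) @ \oo --> (0 : R).
  by apply: mx_pow_cvg0 => z /hurwitz_cayley_disc -> //.
have cst m q (M : 'M[R]_(m, q)) i j : (fun k : nat => M i j) @ \oo --> (M i j : R) by exact: cvg_cst.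
have FX i j : (fun k => (F ^+ k *m X) i j) @ \oo --> ((0 : 'M[R]_(n, p)) i j : R).
  rewrite -(mul0mx n X); apply: mx_mul_cvg => // a b; rewrite mxE; exact: Fk.
have FXT i j : (fun k => (F ^+ k *m X)^T i j) @ \oo --> ((0 : 'M[R]_(p, n)) i j : R).
  by rewrite mxE; under eq_fun do rewrite mxE; have := FX j i; rewrite mxE.
have : (fun k => V (F ^+ k *m X)) @ \oo --> \tr (S *m 0 *m Q *m (0 : 'M[R]_(p, n))).
  apply: cvg_sumr => i; apply: mx_mul_cvg => //; apply: mx_mul_cvg => //; apply: mx_mul_cvg => //.
rewrite !(mulmx0, mul0mx) mxtrace0 => cv; rewrite -(cvg_lim (@Rhausdorff R) cv); apply: limr_le.
  by apply/cvg_ex; exists 0.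
exact: nearW.
Qed.

End Lyapunov.

(** * Companion realizations *)
Section Jets.
Variable R : comNzRingType.

(** A vector of N + 1 entries stands for the jet (v, v', ..., v^(N)) of a
    function v.  Its head forgets v^(N) and its tail forgets v, so that along a
    trajectory the tail is the derivative of the head. *)
Definition jet_head N : 'M[R]_(N, N.+1) := \matrix_(i, j) (j == i :> nat)%:R.
Definition jet_tail N : 'M[R]_(N, N.+1) := \matrix_(i, j) (j == i.+1 :> nat)%:R.

Lemma jet_headE N p (J : 'M[R]_(N.+1, p)) i j :
  (jet_head N *m J) i j = J (widen_ord (leqnSn N) i) j.
Proof.
rewrite mxE (bigD1 (widen_ord (leqnSn N) i)) //= mxE eqxx mul1r big1 ?addr0 // => l.
by rewrite -val_eqE /= => /negPf li; rewrite mxE li mul0r.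
Qed.

Lemma jet_tailE N p (J : 'M[R]_(N.+1, p)) i j :
  (jet_tail N *m J) i j = J (lift ord0 i) j.
Proof.
rewrite mxE (bigD1 (lift ord0 i)) //= mxE eqxx mul1r big1 ?addr0 // => l.
by rewrite -val_eqE /= => /negPf li; rewrite mxE li mul0r.
Qed.

Lemma sum_delta N (g : nat -> R) (i : nat) :
  \sum_(a < N) (i == a :> nat)%:R * g a = if (i < N)%N then g i else 0.
Proof.
case: ltnP => iN; last by rewrite big1 // => a _; rewrite gtn_eqF ?mul0r // (leq_trans (ltn_ord a)).
rewrite (bigD1 (Ordinal iN)) //= eqxx mul1r big1 ?addr0 // => a.
by rewrite -val_eqE /= eq_sym => /negPf ->; rewrite mul0r.
Qed.

Lemma sum_delta_succ N (g : nat -> R) (i : nat) :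
  \sum_(a < N) (i == a.+1 :> nat)%:R * g a = if (0 < i <= N)%N then g i.-1 else 0.
Proof.
case: i => [|i] /=; first by rewrite big1 // => a _; rewrite mul0r.
by rewrite -sum_delta; apply: eq_bigr => a _; rewrite eqSS.
Qed.

(** The array phi represents a polynomial phi(x, y) of degree at most N in each
    variable, and the alternating sums say that it vanishes for x = - y.  So
    phi = (x + y) S(x, y); multiplying the array S by y or by x amounts to
    placing head and tail matrices on its two sides. *)
Lemma divide_by_sum_of_variables N (phi : nat -> nat -> R) :
  (forall i j, (N < i)%N || (N < j)%N -> phi i j = 0) ->
  (forall m, \sum_(i < m.+1) (-1) ^+ i * phi i (m - i)%N = 0) ->
  exists S : 'M[R]_N, \matrix_(i < N.+1, j < N.+1) phi i j
    = (jet_head N)^T *m S *m jet_tail N + (jet_tail N)^T *m S *m jet_head N.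
Proof.
move=> phi0 alt.
(* the coefficients of phi / (x + y) *)
pose sg i j := (-1) ^+ i * \sum_(l < i.+1) (-1) ^+ l * phi l (i + j.+1 - l)%N : R.
have sgS i j : sg i.+1 j + sg i j.+1 = phi i.+1 j.+1.
  rewrite /sg big_ord_recr /= mulrDr mulrA -expr2 sqrr_sign mul1r addSnnS.
  have -> : (i + j.+2 - i.+1 = j.+1)%N by lia.
  rewrite addrAC -[RHS]add0r; congr (_ + _).
  by rewrite exprS mulN1r mulNr addNr.
have sg0 j : sg 0%N j = phi 0%N j.+1 by rewrite /sg big_ord1 !mul1r subn0.
have sgl i : sg i 0%N = phi i.+1 0%N.
  rewrite /sg addn1; have := alt i.+1; rewrite big_ord_recr /= subnn => /eqP.
  rewrite addr_eq0 => /eqP ->.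
  by rewrite exprS mulN1r mulNr opprK mulrA -expr2 sqrr_sign mul1r.
have phi00 : phi 0%N 0%N = 0 by have := alt 0%N; rewrite big_ord1 mul1r.
have sgN i : sg i N = 0.
  rewrite /sg big1 ?mulr0 // => l _; rewrite phi0 ?mulr0 //.
  by apply/orP; right; have := ltn_ord l; lia.
have sNg j : sg N j = 0.
  have : \sum_(i < N.+1 + j.+1) (-1) ^+ i * phi i (N + j.+1 - i)%N = 0 := alt _.
  rewrite big_split_ord /= [X in _ + X]big1 ?addr0 => [|i _]; last first.
    by rewrite phi0 ?mulr0 //; apply/orP; left; lia.
  by rewrite /sg => ->; rewrite mulr0.
exists (\matrix_(i, j) sg i j); apply/matrixP => i j.
have -> : ((jet_head N)^T *m \matrix_(i, j) sg i j *m jet_tail N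
           + (jet_tail N)^T *m \matrix_(i, j) sg i j *m jet_head N) i j
  = (if (0 < j)%N then sg i j.-1 else 0) + (if (0 < i)%N then sg i.-1 j else 0).
  rewrite mxE; congr (_ + _).
    have -> : (if (0 < j)%N then sg i j.-1 else 0) =
        \sum_(b < N) (j == b.+1 :> nat)%:R * sg i b.
      by rewrite sum_delta_succ (leq_ord j) andbT.
    rewrite mxE; apply: eq_bigr => b _; rewrite !mxE mulrC; congr (_ * _).
    transitivity (\sum_(a < N) (i == a :> nat)%:R * sg a b).
      by apply: eq_bigr => a _; rewrite !mxE.
    rewrite (sum_delta N (sg^~ b)); case: ltnP => // Ni.
    by have -> : val i = N by apply/eqP; rewrite eqn_leq leq_ord.
  have -> : (if (0 < i)%N then sg i.-1 j else 0) =
      \sum_(b < N) (j == b :> nat)%:R * (if (0 < i)%N then sg i.-1 b else 0).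
    rewrite (sum_delta N (fun b => if (0 < i)%N then sg i.-1 b else 0)).
    case: (ltnP j N) => // Nj; case: ifP => // _.
    by have -> : val j = N by apply/eqP; rewrite eqn_leq leq_ord.
  rewrite mxE; apply: eq_bigr => b _; rewrite !mxE mulrC; congr (_ * _).
  transitivity (\sum_(a < N) (i == a.+1 :> nat)%:R * sg a b).
    by apply: eq_bigr => a _; rewrite !mxE.
  by rewrite (sum_delta_succ N (sg^~ b)) (leq_ord i) andbT.
by rewrite mxE; case: (val i) (val j) => [|i'] [|j'] //=; rewrite ?addr0 ?add0r.
Qed.

Section Companion.
Variables (N : nat) (d : {poly R}).
Hypothesis (d_monic : d`_N = 1).

(** A jet is determined by its head X and by f = d_0 v + ... + d_(N-1) v^(N-1)
    + v^(N), namely as jet_lift X + jet_top f.  The tail of this jet is the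
    right-hand side of the state equation X' = companion_mx X + companion_in f,
    with d a monic polynomial of degree N. *)
Definition jet_lift : 'M[R]_(N.+1, N) :=
  \matrix_(i, j) if (i < N)%N then (i == j :> nat)%:R else - d`_j.
Definition jet_top : 'cV[R]_N.+1 := delta_mx ord_max 0.
Definition companion_mx := jet_tail N *m jet_lift.
Definition companion_in := jet_tail N *m jet_top.
Definition coef_row (f : {poly R}) : 'rV[R]_N.+1 := \row_j f`_j.

Lemma jet_head_lift : jet_head N *m jet_lift = 1%:M.
Proof. by apply/matrixP => i j; rewrite jet_headE !mxE /= ltn_ord. Qed.

Lemma jet_head_top : jet_head N *m jet_top = 0.
Proof.
apply/matrixP => i j; rewrite jet_headE !mxE -val_eqE /= ord1 eqxx andbT.
by rewrite ltn_eqF.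
Qed.

Lemma coef_row_top f : coef_row f *m jet_top = (f`_N)%:M.
Proof.
apply/matrixP => i j; rewrite !ord1 mxE (bigD1 ord_max) //= !mxE eqxx mulr1 big1 ?addr0 // => l.
by move=> /negPf lm; rewrite !mxE lm mulr0.
Qed.

Lemma coef_row_lift : coef_row d *m jet_lift = 0.
Proof.
apply/matrixP => i j; rewrite !mxE big_ord_recr /= !mxE ltnn d_monic mul1r.
transitivity (d`_j - d`_j); last by rewrite subrr.
congr (_ - _); rewrite (bigD1 j) //= !mxE /= ltn_ord eqxx mulr1 big1 ?addr0 // => l.
by rewrite -val_eqE /= => /negPf lj; rewrite !mxE /= ltn_ord lj mulr0.
Qed.

Lemma jet_resolution : jet_lift *m jet_head N + jet_top *m coef_row d = 1%:M.
Proof.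
apply/matrixP => i j; rewrite !mxE big_ord1 !mxE eqxx andbT.
have -> : \sum_(l < N) jet_lift i l * jet_head N l j =
    \sum_(l < N) (j == l :> nat)%:R * (if (i < N)%N then (i == l :> nat)%:R else - d`_l).
  by apply: eq_bigr => l _; rewrite !mxE mulrC.
rewrite (sum_delta N (fun l => if (i < N)%N then (i == l :> nat)%:R else - d`_l)).
rewrite -!val_eqE /=; have := ltn_ord i; rewrite ltnS leq_eqVlt => /orP[/eqP ->|iN].
  rewrite ltnn eqxx mul1r; have := ltn_ord j; rewrite ltnS leq_eqVlt => /orP[/eqP ->|jN].
    by rewrite ltnn add0r d_monic eqxx.
  by rewrite jN addNr gtn_eqF.
rewrite iN (ltn_eqF iN) mul0r addr0; case: ltnP => // Nj.
by rewrite ltn_eqF // (leq_trans iN).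
Qed.

Lemma jet_decomp m (X : 'M[R]_(m, N.+1)) :
  X *m jet_lift *m jet_head N + X *m jet_top *m coef_row d = X.
Proof. by rewrite -!mulmxA -mulmxDr jet_resolution mulmx1. Qed.

Lemma jetP p (X : 'M[R]_(N, p)) (f : 'M[R]_(1, p)) :
  let J := jet_lift *m X + jet_top *m f in
  [/\ jet_head N *m J = X, coef_row d *m J = f
    & jet_tail N *m J = companion_mx *m X + companion_in *m f].
Proof.
split; rewrite mulmxDr !mulmxA //.
- by rewrite jet_head_lift jet_head_top mul1mx mul0mx addr0.
- by rewrite coef_row_lift mul0mx add0r coef_row_top d_monic mul1mx.
Qed.

End Companion.

(** For X the head of J and X' its tail, the right-hand side is the derivative
    of \tr (S X Q X^T) along the trajectory. *)
Lemma trace_storage N p (S : 'M[R]_N) (Q : 'M[R]_p) (J : 'M[R]_(N.+1, p)) :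
  \tr (((jet_head N)^T *m S *m jet_tail N + (jet_tail N)^T *m S *m jet_head N) *m J *m Q *m J^T)
  = \tr (S *m (jet_tail N *m J) *m Q *m (jet_head N *m J)^T)
  + \tr (S *m (jet_head N *m J) *m Q *m (jet_tail N *m J)^T).
Proof.
rewrite !mulmxDl mxtraceD; congr (_ + _).
  by rewrite -!mulmxA mxtrace_mulC trmx_mul !mulmxA.
by rewrite -!mulmxA mxtrace_mulC trmx_mul !mulmxA.
Qed.

Lemma trace_rank1 m p (f g : 'rV[R]_m) (Q : 'M[R]_p) (J : 'M[R]_(m, p)) :
  \tr (f^T *m g *m J *m Q *m J^T) = (g *m J *m Q *m (f *m J)^T) 0 0.
Proof. by rewrite -!mulmxA mxtrace_mulC trmx_mul !mulmxA /mxtrace big_ord1. Qed.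

End Jets.

(** * Rational functions and transfer functions *)
Section RationalFunctions.
Local Open Scope quotient_scope.
Variable R : realType.
Implicit Types f : {fraction {poly R}}.
Implicit Types u v : {poly R}.

Lemma frac_repr f : f * ((repr f).2)%:F = ((repr f).1)%:F.
Proof.
have d0 := denom_ratioP (repr f).
apply/eqP; rewrite -{1}[f]reprK !piE.
rewrite /FracField.mulf !numden_Ratio ?oner_eq0 ?mulr1 ?mul1r //.
by rewrite equivfE !numden_Ratio ?oner_eq0 ?mulr1 // mulrC.
Qed.

Lemma rden_neq0 f : rden f != 0.
Proof.
rewrite /rden; have := denom_ratioP (repr f).
case: (frac (repr f)) => p q /= q0.
by rewrite divp_eq0 negb_or q0 gcdp_eq0 (negPf q0) andbF -leqNgt dvdp_leq ?dvdp_gcdr.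
Qed.

Lemma rnum_rden f : f = (rnum f)%:F / (rden f)%:F.
Proof.
have d0 : (rden f)%:F != 0 by rewrite tofrac_eq0 rden_neq0.
apply: (canRL (mulfK d0)); move: d0.
have := frac_repr f; have := denom_ratioP (repr f); rewrite /rden /rnum.
case: (frac (repr f)) => p q /= q0 fE d0.
have g0 : (gcdp p q)%:F != 0 by rewrite tofrac_eq0 gcdp_eq0 negb_and q0 orbT.
apply: (mulIf g0); rewrite -mulrA -!tofracM !divpK ?dvdp_gcdl ?dvdp_gcdr //.
Qed.

Lemma rnum0 : rnum (0 : {fraction {poly R}}) = 0.
Proof.
apply/eqP; rewrite -tofrac_eq0; have /esym/eqP := @rnum_rden 0.
by rewrite mulf_eq0 invr_eq0 [X in _ || X]tofrac_eq0 (negPf (rden_neq0 0)) orbF.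
Qed.

Lemma size_rden0 : size (rden (0 : {fraction {poly R}})) = 1%N.
Proof.
have := frac_repr 0; rewrite mul0r => /esym/eqP; rewrite tofrac_eq0 /rden.
have := denom_ratioP (repr (0 : {fraction {poly R}})).
case: (frac (repr (0 : {fraction {poly R}}))) => p q /= q0 /eqP ->.
by rewrite gcd0p divpp // size_poly1.
Qed.

End RationalFunctions.

(* The embedding phi of polynomials into rational functions is an abstract
   morphism here, so that unification never looks into the construction of the
   field of fractions. *)
Section Resolvent.
Variables (R : realType) (F : fieldType) (phi : {rmorphism {poly R} -> F}).
Hypothesis phi_eq0 : forall p, (phi p == 0) = (p == 0).

Definition cmx m n (M : 'M[R]_(m, n)) : 'M[F]_(m, n) := map_mx (fun a => phi a%:P) M.

Lemma cmxE m n (M : 'M[R]_(m, n)) :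
  cmx M = map_mx (phi) (map_mx polyC M).
Proof. by rewrite -map_mx_comp; apply: eq_map_mx. Qed.

Lemma cmxM m n p (M1 : 'M[R]_(m, n)) (M2 : 'M[R]_(n, p)) :
  cmx (M1 *m M2) = cmx M1 *m cmx M2.
Proof. by rewrite !cmxE !map_mxM. Qed.

Lemma cmxD m n (M1 M2 : 'M[R]_(m, n)) :
  cmx (M1 + M2) = cmx M1 + cmx M2.
Proof. by rewrite !cmxE !map_mxD. Qed.

Definition resolvent n (A : 'M[R]_n) : 'M[F]_n := invmx ((phi 'X)%:M - cmx A).

Lemma sub_cmxE n (A : 'M[R]_n) :
  (phi 'X)%:M - cmx A = map_mx (phi) (char_poly_mx A).
Proof.
rewrite /char_poly_mx map_mxB map_scalar_mx /= /cmx -map_mx_comp.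
by congr (_ - _); apply: eq_map_mx.
Qed.

Lemma sub_cmx_unit n (A : 'M[R]_n) : (phi 'X)%:M - cmx A \in unitmx.
Proof.
rewrite sub_cmxE unitmxE det_map_mx unitfE phi_eq0.
exact/monic_neq0/char_poly_monic.
Qed.

Lemma resolvent_shift n (A : 'M[R]_n) : (phi 'X) *: resolvent A = 1%:M + cmx A *m resolvent A.
Proof.
apply/eqP; rewrite -subr_eq; apply/eqP.
by rewrite -(mulmxV (sub_cmx_unit A)) mulmxBl mul_scalar_mx.
Qed.

Lemma size_prod_leq2 n (G : 'I_n -> {poly R}) :
  (forall i, size (G i) <= 2)%N -> (size (\prod_i G i)%R <= n.+1)%N.
Proof.
elim: n G => [|n IH] G G2; first by rewrite big_ord0 size_poly1.
rewrite big_ord_recr /=; apply: leq_trans (size_polyMleq _ _) _.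
apply: (@leq_trans (n.+1 + 2).-1); last by rewrite addn2.
rewrite -!subn1 leq_sub2r // leq_add //.
by apply: IH => i; apply: G2.
Qed.

Lemma size_det_leq n (M : 'M[{poly R}]_n) :
  (forall i j, size (M i j) <= 2)%N -> (size (\det M)%R <= n.+1)%N.
Proof.
move=> M2; apply: leq_trans (size_sum _ _ _) _; apply/bigmax_leqP => s _.
rewrite -signr_odd; case: (odd _); rewrite ?expr0 ?expr1 ?mul1r ?mulN1r ?size_polyN.
  by apply: size_prod_leq2 => i.
by apply: size_prod_leq2 => i.
Qed.

Lemma size_char_poly_mx_leq n (A : 'M[R]_n) i j : (size (char_poly_mx A i j)%R <= 2)%N.
Proof.
rewrite !mxE; apply: leq_trans (size_polyD _ _) _.
rewrite size_polyN size_polyC geq_max; apply/andP; split; last by case: (_ != _).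
by case: (_ == _); rewrite ?mulr1n ?mulr0n ?size_polyX ?size_poly0.
Qed.

Lemma size_adj_leq n (A : 'M[R]_n) i j : (size (\adj (char_poly_mx A) i j)%R <= n)%N.
Proof.
rewrite mxE /cofactor -signr_odd; case: n A i j => [|n] A i j; first by case: i.
have h : (size (\det (row' j (col' i (char_poly_mx A))))%R <= n.+1)%N.
  by apply: size_det_leq => a b; rewrite 2!mxE size_char_poly_mx_leq.
by case: (odd _); rewrite ?expr0 ?expr1 ?mul1r ?mulN1r ?size_polyN.
Qed.

(** Cramer's rule: the entries of the adjugate have degree less than n, so the
    function is strictly proper. *)
Lemma resolvent_entry n (A : 'M[R]_n) (c : 'rV[R]_n) (b : 'cV[R]_n) :
  exists2 u : {poly R}, (size u <= n)%N &
  (cmx c *m resolvent A *m cmx b) 0 0 = (phi u) / phi (char_poly A).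
Proof.
exists ((map_mx polyC c *m \adj (char_poly_mx A) *m map_mx polyC b) 0 0).
  rewrite mxE; apply: leq_trans (size_sum _ _ _) _; apply/bigmax_leqP => j _.
  rewrite mulrC !mxE mul_polyC (leq_trans (size_scale_leq _ _)) //.
  apply: leq_trans (size_sum _ _ _) _; apply/bigmax_leqP => i _.
  rewrite mxE mul_polyC (leq_trans (size_scale_leq _ _)) //; exact: size_adj_leq.
rewrite /resolvent /invmx sub_cmx_unit sub_cmxE det_map_mx -map_mx_adj.
rewrite -scalemxAr -scalemxAl mxE mulrC; congr (_ / _).
by rewrite !cmxE -!map_mxM mxE.
Qed.

Lemma cross_mul (a b u v x y : F) : x != 0 -> y != 0 ->
  u / x + a = v / y + b -> (a - b) * (x * y) = v * x - u * y.
Proof.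
move=> x0 y0 /(canRL (addKr _)) ->.
by field; rewrite x0 y0.
Qed.

(** Two strictly proper functions that differ by a constant are equal, which
    identifies the direct terms.  Multiplying by the variable replaces c by c A
    and produces the new direct term c b; iterating identifies all Markov
    parameters. *)
Lemma markov_unique n1 n2 (A1 : 'M[R]_n1) (c1 : 'rV[R]_n1) (b1 : 'cV[R]_n1)
    (A2 : 'M[R]_n2) (c2 : 'rV[R]_n2) (b2 : 'cV[R]_n2) (D1 D2 : R) :
  (cmx c1 *m resolvent A1 *m cmx b1) 0 0 + phi D1%:P =
  (cmx c2 *m resolvent A2 *m cmx b2) 0 0 + phi D2%:P ->
  D1 = D2 /\ forall p, (c1 *m A1 ^+ p *m b1) 0 0 = (c2 *m A2 ^+ p *m b2) 0 0.
Proof.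
have base (c1' : 'rV[R]_n1) (c2' : 'rV[R]_n2) D1' D2' :
  (cmx c1' *m resolvent A1 *m cmx b1) 0 0 + phi D1'%:P =
  (cmx c2' *m resolvent A2 *m cmx b2) 0 0 + phi D2'%:P ->
  D1' = D2'.
  have [u1 s1 ->] := resolvent_entry A1 c1' b1.
  have [u2 s2 ->] := resolvent_entry A2 c2' b2.
  have m1 := char_poly_monic A1; have m2 := char_poly_monic A2.
  have z1 := monic_neq0 m1; have z2 := monic_neq0 m2.
  move=> E; apply/eqP; rewrite -subr_eq0; apply: contraT => D0.
  have : (D1' - D2')%:P * (char_poly A1 * char_poly A2) =
         u2 * char_poly A1 - u1 * char_poly A2.
    apply/eqP; rewrite -subr_eq0 -phi_eq0 !(rmorphB, rmorphM) /= subr_eq0; apply/eqP.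
    by apply: cross_mul E; rewrite phi_eq0.
  move/(congr1 (fun p : {poly R} => size p)).
  rewrite mul_polyC size_scale // size_mul // !size_char_poly.
  have : (size (u2 * char_poly A1 - u1 * char_poly A2)%R <= n1 + n2)%N.
    apply: leq_trans (size_polyD _ _) _; rewrite size_polyN geq_max.
    have h1 := size_polyMleq u2 (char_poly A1); have h2 := size_polyMleq u1 (char_poly A2).
    rewrite !size_char_poly !addnS /= in h1 h2; apply/andP; split.
      by apply: leq_trans h1 _; rewrite addnC leq_add2l.
    by apply: leq_trans h2 _; rewrite leq_add2r.
  by move=> + h; rewrite -h; lia.
move=> E; have D12 := base _ _ _ _ E; split => // p.
have : (cmx c1 *m resolvent A1 *m cmx b1) 0 0 =
  (cmx c2 *m resolvent A2 *m cmx b2) 0 0.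
  by move: E; rewrite D12 => /addIr.
have shift n (A : 'M[R]_n) (c : 'rV[R]_n) (b : 'cV[R]_n) :
    (phi 'X) * (cmx c *m resolvent A *m cmx b) 0 0 =
    (cmx (c *m A) *m resolvent A *m cmx b) 0 0 + phi ((c *m b) 0 0)%:P.
  have -> : phi ((c *m b) 0 0)%:P = cmx (c *m b) 0 0 by rewrite [RHS]mxE.
  have addE (M1 M2 : 'M[F]_1) : M1 0 0 + M2 0 0 = (M1 + M2) 0 0 by rewrite mxE.
  rewrite !cmxM addrC addE -mulmxDl.
  have -> : cmx c + cmx c *m cmx A *m resolvent A = cmx c *m (phi 'X *: resolvent A).
    by rewrite resolvent_shift mulmxDr mulmx1 mulmxA.
  by rewrite -scalemxAr -scalemxAl [RHS]mxE.
elim: p c1 c2 {E} => [|p IH] c1' c2' /(congr1 (fun x => (phi 'X) * x)); rewrite !shift => E.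
  by rewrite !expr0 !mulmx1; exact: base E.
rewrite !exprS -[A1 * _]/(A1 *m _) -[A2 * _]/(A2 *m _) !mulmxA; apply: IH.
by have E' := E; move: E'; rewrite (base _ _ _ _ E) => /addIr.
Qed.

Section CompanionTransfer.
Variables (N : nat) (d : {poly R}).
Hypotheses (d_monic : d`_N = 1) (d_size : size d = N.+1).

Lemma coef_row_monomials (K : comNzRingType) (g : {poly K}) (z : K) :
  (size g <= N.+1)%N -> coef_row N g *m (\col_i z ^+ i) = (g.[z])%:M.
Proof.
move=> sg; apply/matrixP => i j; rewrite !ord1 !mxE (horner_coef_wide _ sg) mulr1n.
by apply: eq_bigr => l _; rewrite !mxE.
Qed.

(** The vector m of the powers of the variable X satisfies tail m = X head m and
    coef_row g m = g.  Hence head m / d is the response of the state to a unit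
    input. *)
Lemma companion_transfer (n : {poly R}) : (size n <= N.+1)%N ->
  (cmx (coef_row N n *m jet_lift N d) *m resolvent (companion_mx N d)
     *m cmx (companion_in R N)) 0 0 + phi (n`_N)%:P = (phi n) / (phi d).
Proof.
move=> sn.
pose m : 'cV[F]_N.+1 := \col_i (phi 'X) ^+ i.
have d0 : (phi d) != 0 by rewrite phi_eq0 -size_poly_eq0 d_size.
have rowm (g : {poly R}) : (size g <= N.+1)%N -> cmx (coef_row N g) *m m = ((phi g))%:M.
  move=> sg.
  have -> : cmx (coef_row N g) = coef_row N (map_poly (phi) (map_poly polyC g)).
    by apply/matrixP => i j; rewrite !mxE !coef_map.
  rewrite coef_row_monomials; last first.
    by rewrite (leq_trans (size_poly _ _)) // (leq_trans (size_poly _ _)).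
  by rewrite horner_map /= -[_.[_]]/(g \Po 'X) comp_polyXr.
have tailm : cmx (jet_tail R N) *m m = (phi 'X) *: (cmx (jet_head R N) *m m).
  have -> : cmx (jet_tail R N) = jet_tail F N.
    by apply/matrixP => i j; rewrite !mxE; case: (_ == _); rewrite ?(rmorph1, rmorph0).
  have -> : cmx (jet_head R N) = jet_head F N.
    by apply/matrixP => i j; rewrite !mxE; case: (_ == _); rewrite ?(rmorph1, rmorph0).
  by apply/matrixP => i j; rewrite jet_tailE [RHS]mxE jet_headE !mxE exprS.
have res : resolvent (companion_mx N d) *m cmx (companion_in R N) =
    (phi d)^-1 *: (cmx (jet_head R N) *m m).
  have uA := sub_cmx_unit (companion_mx N d).
  apply: (canLR (mulKmx uA)).
  rewrite -scalemxAr mulmxBl mul_scalar_mx -tailm.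
  rewrite -{1}(jet_decomp d_monic (jet_tail R N)) cmxD !cmxM.
  rewrite mulmxDl -[_ *m cmx (coef_row N d) *m m]mulmxA rowm ?d_size //.
  rewrite -[_ *m cmx (jet_head R N) *m m]mulmxA -cmxM addrAC subrr add0r.
  by rewrite mul_mx_scalar scalerA mulVf // scale1r.
rewrite -mulmxA res -scalemxAr.
have E2 : cmx (coef_row N n *m jet_lift N d) *m (cmx (jet_head R N) *m m)
    + (phi (n`_N)%:P * phi d)%:M = (phi n)%:M.
  rewrite -rowm // -[in RHS](jet_decomp d_monic (coef_row N n)) cmxD mulmxDl; congr (_ + _).
    by rewrite mulmxA -cmxM.
  rewrite cmxM -mulmxA rowm ?d_size // coef_row_top mul_mx_scalar mulrC -scale_scalar_mx.
  by congr (_ *: _); apply/matrixP => i j; rewrite !ord1 !mxE !mulr1n.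
have {E2} := congr1 (fun M : 'M[F]_1 => M 0 0) E2; rewrite /= mxE [in X in _ + X]mxE [in RHS]mxE !mulr1n => <-.
by rewrite mxE; field.
Qed.

End CompanionTransfer.

End Resolvent.

Section HurwitzCompanion.
Variable R : realType.

(** An eigenvector for z is the head of a jet annihilated by coef_row d whose
    tail is z times its head.  Such a jet is a multiple of (1, z, ..., z^N), so
    d(z) = 0. *)
Lemma hurwitz_companion N (d : {poly R}) : d`_N = 1 -> size d = N.+1 ->
  (forall z : R[i], root (polyC_ d) z -> complex.Re z < 0) -> hurwitz (companion_mx N d).
Proof.
move=> dN sd d_lt z; rewrite eigenvalue_root_char => zr; apply: d_lt.
have : eigenvalue (map_mx (toC R) (companion_mx N d))^T z.
  rewrite eigenvalue_root_char /char_poly -det_tr /char_poly_mx linearB /= tr_scalar_mx.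
  by rewrite -map_trmx trmxK.
move/eigenvalueP => [x xA x0].
have sC : size (polyC_ d) = N.+1 by rewrite size_map_poly.
have dC : (polyC_ d)`_N = 1 by rewrite coef_map dN.
have mapC : map_mx (toC R) (companion_mx N d) = companion_mx N (polyC_ d).
  rewrite /companion_mx map_mxM; congr (_ *m _); apply/matrixP => i j; rewrite !mxE.
    by case: (_ == _).
  by case: ifP => _; [case: (_ == _)|rewrite coef_map rmorphN].
have [hJ dJ tJ] := jetP dC x^T 0.
move: hJ dJ tJ; rewrite mulmx0 addr0.
move: (jet_lift N (polyC_ d) *m x^T) => J hJ dJ tJ.
have hE i : x^T i 0 = J (widen_ord (leqnSn N) i) 0 by rewrite -jet_headE hJ.
have Jz i : J i 0 = z ^+ i * J 0 0.
  case: i => i /=; elim: i => [|i IH] iN.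
    by rewrite expr0 mul1r; congr (J _ _); apply/val_inj.
  have iN' : (i < N)%N by [].
  have := congr1 (fun M : 'cV[R[i]]_N => M (Ordinal iN') 0) tJ.
  rewrite mulmx0 addr0 /= jet_tailE.
  have -> : (companion_mx N (polyC_ d) *m x^T) (Ordinal iN') 0 =
      z * J (widen_ord (leqnSn N) (Ordinal iN')) 0.
    by rewrite -mapC -[_ *m x^T]trmxK trmx_mul trmxK xA -hE !mxE.
  have -> : lift ord0 (Ordinal iN') = Ordinal iN by apply/val_inj.
  move=> ->; have -> : widen_ord (leqnSn N) (Ordinal iN') = Ordinal (ltnW iN) by apply/val_inj.
  by rewrite IH exprS mulrA.
have J0 : J 0 0 != 0.
  apply: contraNneq x0 => J0; rewrite -trmx_eq0 -hJ; apply/eqP/matrixP => i j.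
  by rewrite jet_headE ord1 Jz J0 mulr0 mxE.
apply/rootP/eqP; rewrite -(mulIr_eq0 _ (mulIf J0)).
have := coef_row_monomials z (eq_leq sC) => /(congr1 (fun M : 'M[R[i]]_1 => M 0 0)).
rewrite [in RHS]mxE mulr1n => <-; apply/eqP.
have := congr1 (fun M : 'M[R[i]]_1 => M 0 0) dJ; rewrite [in RHS]mxE => <-.
rewrite !mxE mulr_suml; apply: eq_bigr => i _.
by rewrite -mulrA [J i 0]Jz; congr (_ * (_ * _)); rewrite mxE.
Qed.

End HurwitzCompanion.

(** * Scalar uncertainties *)
Section ScalarUncertainty.
Variable R : realType.

(** On the imaginary axis this is q |d|^2 + 2 s Re (n conj d) + r |n|^2, the
    quadratic form defining the set of admissible values, evaluated at n / d and
    cleared of its denominator. *)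
Definition supply_poly (q s r : R) (d n : {poly R}) : {poly R} :=
  q *: (d * (d \Po - 'X)) + s *: (d * (n \Po - 'X) + n * (d \Po - 'X)) + r *: (n * (n \Po - 'X)).

Lemma Vset_form k (q s r : R) (M : 'M[R[i]]_k) : Vset (mx22 q s r) k M ->
  exists2 v : R[i], M = v%:M & 0 <= q%:C%C + s%:C%C * (v + v^*%C) + r%:C%C * (v * v^*%C).
Proof.
move=> [v /= v_ge0 <-]; exists v => //.
have s0 : fintype.split (ord0 : 'I_(1 + 1)) = inl 0.
  by apply: (can_inj (@unsplitK 1 1)); rewrite splitK; apply/val_inj.
have s1 : fintype.split (lift ord0 ord0 : 'I_(1 + 1)) = inr 0.
  by apply: (can_inj (@unsplitK 1 1)); rewrite splitK; apply/val_inj.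
move: v_ge0; rewrite !mxE !big_ord_recl !big_ord0 /= !mxE !big_ord_recl !big_ord0 !mxE /=.
rewrite s0 s1 !mxE !eqxx !mulr1n /=.
set x := _ + _; set y := (X in _ -> 0 <= X) => x0; suff -> : y = x by [].
rewrite /x /y conjC1 -[(v^* )%R]/(v^*%C); ring.
Qed.

Lemma supply_poly_ge0 (q s r : R) (d n : {poly R}) (v : R[i]) w :
  (polyC_ n).[(0 +i* w)%C] = v * (polyC_ d).[(0 +i* w)%C] ->
  0 <= q%:C%C + s%:C%C * (v + v^*%C) + r%:C%C * (v * v^*%C) ->
  0 <= (polyC_ (supply_poly q s r d n)).[(0 +i* w)%C].
Proof.
move=> nE v_ge0.
have cE (f : {poly R}) : (polyC_ (f \Po - 'X)).[(0 +i* w)%C] = (((polyC_ f).[(0 +i* w)%C])^*)%C.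
  rewrite map_comp_poly rmorphN /= map_polyX horner_comp hornerN hornerX -horner_polyC_conj.
  by congr (_.[_]); apply/eqP; rewrite eq_complex /= oppr0 !eqxx.
rewrite /supply_poly !(rmorphD, rmorphM) /= !map_polyZ !(rmorphD, rmorphM) /=.
rewrite !(hornerD, hornerZ, hornerM) !cE nE rmorphM /=.
set D := (polyC_ d).[_].
have -> : q%:C%C * (D * D^*%C) + s%:C%C * (D * (v^*%C * D^*%C) + v * D * D^*%C)
  + r%:C%C * (v * D * (v^*%C * D^*%C)) =
  (q%:C%C + s%:C%C * (v + v^*%C) + r%:C%C * (v * v^*%C)) * (D * D^*%C) by ring.
by rewrite mulr_ge0 // mulcJ_ge0.
Qed.

(** Rational functions that agree on the imaginary axis are equal, so the
    off-diagonal entries vanish and the diagonal ones coincide. *)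
Lemma scalar_transfer k (G : 'M[{fraction {poly R}}]_k) (j0 : 'I_k) (q s r : R) :
  RHinf G -> (forall w, Vset (mx22 q s r) k (freq_resp G w)) ->
  exists N (d n : {poly R}), [/\ d`_N = 1 /\ size d = N.+1, (size n <= N.+1)%N,
    forall z : R[i], root (polyC_ d) z -> complex.Re z < 0,
    forall w, 0 <= (polyC_ (supply_poly q s r d n)).[(0 +i* w)%C] &
    forall i j, G i j = (i == j)%:R * (n%:F / d%:F)].
Proof.
move=> GH GV.
have rd i j w : (polyC_ (rden (G i j))).[(0 +i* w)%C] != 0.
  by have [_ np] := GH i j; apply/negP => /eqP /rootP; apply: np => /=.
have off i j : i != j -> G i j = 0.
  move=> ij; have n0 : rnum (G i j) = 0.
    apply: poly_eq_on_imaginary_axis => w; rewrite rmorph0 horner0.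
    have [v /matrixP /(_ i j) + _] := Vset_form (GV (Some w)).
    rewrite !mxE (negPf ij) mulr0n => /eqP.
    by rewrite /reval mulf_eq0 invr_eq0 (negPf (rd _ _ _)) orbF => /eqP.
  by rewrite [G i j]rnum_rden n0 tofrac0 mul0r.
have diag i : G i i = G j0 j0.
  suff E : rnum (G i i) * rden (G j0 j0) = rnum (G j0 j0) * rden (G i i).
    have D0 i' : (rden (G i' i'))%:F != 0 by rewrite tofrac_eq0 rden_neq0.
    rewrite [LHS]rnum_rden [RHS]rnum_rden; apply/eqP.
    by rewrite eqr_div // -!tofracM E.
  apply: poly_eq_on_imaginary_axis => w; rewrite !rmorphM !hornerM.
  have [v /matrixP vE _] := Vset_form (GV (Some w)).
  have := vE i i; have := vE j0 j0; rewrite !mxE !eqxx => <- /eqP.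
  by rewrite /reval eqr_div ?rd // => /eqP.
set f := G j0 j0; set c := lead_coef (rden f).
have c0 : c != 0 by rewrite lead_coef_eq0 rden_neq0.
pose d := c^-1 *: rden f; pose n := c^-1 *: rnum f; pose N := (size (rden f)).-1.
have NE : size (rden f) = N.+1 by rewrite prednK // size_poly_gt0 rden_neq0.
have sd : size d = N.+1 by rewrite size_scale ?invr_eq0.
have dN : d`_N = 1 by rewrite coefZ -/(lead_coef _) mulVf.
have sn : (size n <= N.+1)%N.
  rewrite size_scale ?invr_eq0 // -NE leqNgt; apply/negP.
  by have [] := GH j0 j0.
exists N, d, n; split => //.
- move=> z; rewrite /root map_polyZ hornerZ mulf_eq0 fmorph_eq0 invr_eq0 (negPf c0) /= => rz.
  by rewrite ltNge; apply/negP => z0; have [_] := GH j0 j0; apply; first exact: z0.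
- move=> w; have [v /matrixP /(_ j0 j0) + v_ge0] := Vset_form (GV (Some w)).
  rewrite !mxE eqxx mulr1n => vE; apply: (supply_poly_ge0 _ v_ge0).
  rewrite -vE /reval /n /d !map_polyZ !hornerZ mulrCA -/f; congr (_ * _).
  by rewrite divfK // rd.
- move=> i j; have [->|/off ->] := eqVneq i j; last by rewrite mul0r.
  rewrite diag mul1r [LHS]rnum_rden; apply/eqP; rewrite eqr_div ?tofrac_eq0 ?rden_neq0 //; last first.
    by rewrite -size_poly_eq0 sd.
  by rewrite -!tofracM tofrac_eq /n /d -scalerAl -scalerAr.
Qed.

Lemma row_mul_col (K : nzRingType) m n p (A : 'M[K]_(m, n)) (B : 'M[K]_(n, p)) i j :
  (row i A *m col j B) 0 0 = (A *m B) i j.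
Proof. by rewrite !mxE; apply: eq_bigr => l _; rewrite !mxE. Qed.

Lemma cmx0 (F : fieldType) (phi : {rmorphism {poly R} -> F}) m n :
  cmx phi (0 : 'M[R]_(m, n)) = 0.
Proof. by apply/matrixP => i j; rewrite !mxE rmorph0. Qed.

(** The realization of Delta may have hidden modes outside the left half-plane;
    its Markov parameters depend on the transfer function alone. *)
Lemma scalar_impulse_response nD k (Delta : lti R nD k k) N (d n : {poly R}) :
  d`_N = 1 -> size d = N.+1 -> (size n <= N.+1)%N ->
  (forall i j, transfer Delta i j = (i == j)%:R * (n%:F / d%:F)) ->
  ltiD Delta = (n`_N)%:M /\
  forall p, ltiC Delta *m ltiA Delta ^+ p *m ltiB Delta =
        ((coef_row N n *m jet_lift N d *m companion_mx N d ^+ p *m companion_in R N) 0 0)%:M.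
Proof.
move=> dN sd sn GE.
have mk i j : (ltiD Delta) i j = (i == j)%:R * n`_N /\ forall p,
   (row i (ltiC Delta) *m ltiA Delta ^+ p *m col j (ltiB Delta)) 0 0 =
   ((i == j)%:R *: (coef_row N n *m jet_lift N d) *m companion_mx N d ^+ p *m companion_in R N) 0 0.
  pose phi : {rmorphism {poly R} -> {fraction {poly R}}} := @tofrac {poly R}.
  have phi0 p : (phi p == 0) = (p == 0) by rewrite tofrac_eq0.
  apply: (markov_unique phi0).
  have cE a b (M : 'M[R]_(a, b)) : cmx phi M = const_rmx M by [].
  rewrite [cmx _ (row i _)]map_row [cmx _ (col j _)]map_col -row_mul row_mul_col.
  have := GE i j; rewrite -(companion_transfer phi0 dN sd sn) mxE [const_rmx (ltiD _) i j]mxE => ->.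
  case: (i == j); rewrite ?mul1r ?scale1r // !mul0r scale0r cmx0 !mul0mx mxE.
  by rewrite polyC0 rmorph0 addr0.
split.
- by apply/matrixP => i j; have [-> _] := mk i j; rewrite !mxE; case: (i == j); rewrite ?mul1r ?mul0r.
- move=> p; apply/matrixP => i j; have [_ /(_ p)] := mk i j.
  by rewrite -row_mul row_mul_col => ->; rewrite -!scalemxAl !mxE mulr_natl.
Qed.

Lemma scalar_uncertainty k (G : 'M[{fraction {poly R}}]_k) (q s r : R) : r <= 0 ->
  RHinf G -> (forall w, Vset (mx22 q s r) k (freq_resp G w)) ->
  exists N (d n : {poly R}), [/\ d`_N = 1 /\ size d = N.+1, (size n <= N.+1)%N,
    forall z : R[i], root (polyC_ d) z -> complex.Re z < 0,
    forall w, 0 <= (polyC_ (supply_poly q s r d n)).[(0 +i* w)%C] &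
    forall i j, G i j = (i == j)%:R * (n%:F / d%:F)].
Proof.
case: k G => [|k] G r0 GH GV; last exact: (scalar_transfer ord0 GH GV).
have [v _ v_ge0] := Vset_form (GV None).
(* An empty matrix provides no entry to take n and d from.  Some admissible
   value v exists, and as r <= 0 its real part is admissible too. *)
exists 0%N, 1, ((complex.Re v)%:P); split.
- by rewrite coefC size_poly1.
- by rewrite size_polyC; case: (_ != _).
- by move=> z; rewrite rmorph1 /root hornerC oner_eq0.
- move=> w; rewrite /supply_poly !comp_polyC !mul1r !mulr1.
  rewrite !(rmorphD, rmorphM) /= !map_polyZ !(rmorphD, rmorphM) /= rmorph1 !map_polyC.
  rewrite !(hornerD, hornerZ, hornerM, hornerC) mulr1.
  move: v_ge0; case: v => a b; rewrite !lecE /= => /andP[_ h]; apply/andP; split.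
    by apply/eqP; ring.
  have := mulr_le0_ge0 r0 (sqr_ge0 b); nra.
- by case.
Qed.

End ScalarUncertainty.

(** * A storage function for the uncertainty *)
Section StorageFunction.
Variable R : realType.

Lemma coef_comp_oppX (g : {poly R}) i : (g \Po - 'X)`_i = (-1) ^+ i * g`_i.
Proof.
have -> : g \Po - 'X = \poly_(j < size g) ((-1) ^+ j * g`_j).
  rewrite comp_polyE poly_def; apply: eq_bigr => j _.
  by rewrite -scaleN1r exprZn scalerA mulrC.
rewrite coef_poly; case: ltnP => // gi.
by rewrite nth_default // mulr0.
Qed.

Lemma alternating_coef (f g : {poly R}) m :
  \sum_(i < m.+1) (-1) ^+ i * (f`_i * g`_(m - i)) = (-1) ^+ m * (f * (g \Po - 'X))`_m.
Proof.
rewrite coefM mulr_sumr; apply: eq_bigr => i _; rewrite coef_comp_oppX.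
have -> : (-1) ^+ m = (-1) ^+ i * (-1) ^+ (m - i) :> R by rewrite -exprD subnKC // leq_ord.
have sq : (-1) ^+ (m - i) * (-1) ^+ (m - i) = 1 :> R by rewrite -expr2 sqrr_sign.
transitivity ((-1) ^+ i * (f`_i * ((-1) ^+ (m - i) * (-1) ^+ (m - i) * g`_(m - i)))); last by ring.
by rewrite sq mul1r.
Qed.

(** A Kalman-Yakubovich-Popov equality.  As a polynomial in two variables, the
    left-hand side restricts to supply_poly - h1 h1~ - h2 h2~ = 0 for y = -x,
    hence is divisible by x + y. *)
Lemma kyp_equality N (q s r : R) (d n : {poly R}) : size d = N.+1 -> (size n <= N.+1)%N ->
  (forall w, 0 <= (polyC_ (supply_poly q s r d n)).[(0 +i* w)%C]) ->
  exists (h1 h2 : {poly R}) (S : 'M[R]_N),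
    q *: ((coef_row N d)^T *m coef_row N d)
    + s *: ((coef_row N d)^T *m coef_row N n + (coef_row N n)^T *m coef_row N d)
    + r *: ((coef_row N n)^T *m coef_row N n)
    - (coef_row N h1)^T *m coef_row N h1 - (coef_row N h2)^T *m coef_row N h2
  = (jet_head R N)^T *m S *m jet_tail R N + (jet_tail R N)^T *m S *m jet_head R N.
Proof.
move=> sd sn /spectral_factorization[h1 [h2 [hE s1 s2]]].
have sX (g : {poly R}) : size (g \Po - 'X) = size g.
  by rewrite size_comp_poly2 // size_polyN size_polyX.
have sM (f g : {poly R}) : (size f <= N.+1)%N -> (size g <= N.+1)%N ->
    (size (f * (g \Po - 'X))%R <= N.*2.+1)%N.
  move=> sf sg; apply: leq_trans (size_polyMleq _ _) _; rewrite sX.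
  by rewrite -addnn -addnS -[X in (_ <= X)%N]/(N.+1 + N.+1).-1 -!subn1 leq_sub2r // leq_add.
have sE : (size (supply_poly q s r d n) <= N.*2.+1)%N.
  have sD (f g : {poly R}) : (size f <= N.*2.+1)%N -> (size g <= N.*2.+1)%N ->
      (size (f + g)%R <= N.*2.+1)%N.
    by move=> sf sg; apply: leq_trans (size_polyD _ _) _; rewrite geq_max sf.
  have sZ c (f : {poly R}) : (size f <= N.*2.+1)%N -> (size (c *: f)%R <= N.*2.+1)%N.
    by apply: leq_trans; exact: size_scale_leq.
  have sd' : (size d <= N.+1)%N by rewrite sd.
  have s3 := sD _ _ (sM _ _ sd' sn) (sM _ _ sn sd').
  exact: sD _ _ (sD _ _ (sZ q _ (sM _ _ sd' sd')) (sZ s _ s3)) (sZ r _ (sM _ _ sn sn)).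
have sh (h : {poly R}) : ((size h).*2 <= (size (supply_poly q s r d n)).+1)%N -> (size h <= N.+1)%N.
  by move=> hs; rewrite -leq_double (leq_trans hs).
pose phi i j := q * (d`_i * d`_j) + s * (d`_i * n`_j + n`_i * d`_j) + r * (n`_i * n`_j)
  - h1`_i * h1`_j - h2`_i * h2`_j.
have [| |S SE] := @divide_by_sum_of_variables R N phi.
- move=> i j ij; have z (f g : {poly R}) : (size f <= N.+1)%N -> (size g <= N.+1)%N -> f`_i * g`_j = 0.
    move=> sf sg; case/orP: ij => Nij.
      by rewrite nth_default ?mul0r // (leq_trans sf).
    by rewrite mulrC nth_default ?mul0r // (leq_trans sg).
  have sd' : (size d <= N.+1)%N by rewrite sd.
  rewrite /phi (z _ _ sd' sd') (z _ _ sd' sn) (z _ _ sn sd') (z _ _ sn sn).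
  rewrite (z _ _ (sh _ s1) (sh _ s1)) (z _ _ (sh _ s2) (sh _ s2)); ring.
- move=> m; pose A (f g : {poly R}) := \sum_(i < m.+1) (-1) ^+ i * (f`_i * g`_(m - i)).
  transitivity (q * A d d + s * (A d n + A n d) + r * A n n - A h1 h1 - A h2 h2).
    rewrite /A -big_split !mulr_sumr -!big_split /= -!sumrB; apply: eq_bigr => i _.
    rewrite /phi; ring.
  have := congr1 (fun p : {poly R} => (-1) ^+ m * p`_m) hE.
  rewrite /A !alternating_coef /supply_poly !(coefD, coefZ) => E.
  transitivity ((-1) ^+ m * (q * (d * (d \Po - 'X))`_m + s * ((d * (n \Po - 'X))`_m
    + (n * (d \Po - 'X))`_m) + r * (n * (n \Po - 'X))`_m)
    - (-1) ^+ m * ((h1 * (h1 \Po - 'X))`_m + (h2 * (h2 \Po - 'X))`_m)); last by rewrite E subrr.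
  by ring.
exists h1, h2, S; rewrite -SE; apply/matrixP => i j; rewrite !mxE !big_ord1 !mxE /phi; ring.
Qed.

Definition bilin p (Q : 'M[R]_p) (u v : 'rV[R]_p) : R := (u *m Q *m v^T) 0 0.

(** Testing kyp_equality against J Q J^T gives the dissipation equality, in which
    f is the input and g the output of n / d.  With f = 0 it turns into a Lyapunov
    inequality because r <= 0, whence the sign of the storage. *)
Lemma storage_function N (q s r : R) (d n : {poly R}) :
  d`_N = 1 -> size d = N.+1 -> (size n <= N.+1)%N -> r <= 0 ->
  (forall z : R[i], root (polyC_ d) z -> complex.Re z < 0) ->
  (forall w, 0 <= (polyC_ (supply_poly q s r d n)).[(0 +i* w)%C]) ->
  exists (h1 h2 : 'rV[R]_N.+1) (S : 'M[R]_N), forall p (Q : 'M[R]_p),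
  [/\ forall (X : 'M[R]_(N, p)) (f : 'rV[R]_p),
    let J := jet_lift N d *m X + jet_top R N *m f in
    let X' := companion_mx N d *m X + companion_in R N *m f in
    let g := coef_row N n *m J in
    q * bilin Q f f + s * (bilin Q f g + bilin Q g f) + r * bilin Q g g
    = bilin Q (h1 *m J) (h1 *m J) + bilin Q (h2 *m J) (h2 *m J)
      + (\tr (S *m X' *m Q *m X^T) + \tr (S *m X *m Q *m X'^T)) &
    (forall u, 0 <= bilin Q u u) -> forall X : 'M[R]_(N, p), 0 <= \tr (S *m X *m Q *m X^T)].
Proof.
move=> dN sd sn r0 d_lt /(kyp_equality sd sn)[h1 [h2 [S SE]]].
exists (coef_row N h1), (coef_row N h2), S => p Q.
have diss (X : 'M[R]_(N, p)) (f : 'rV[R]_p) :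
    let J := jet_lift N d *m X + jet_top R N *m f in
    let X' := companion_mx N d *m X + companion_in R N *m f in
    let g := coef_row N n *m J in
    q * bilin Q f f + s * (bilin Q f g + bilin Q g f) + r * bilin Q g g
    = bilin Q (coef_row N h1 *m J) (coef_row N h1 *m J) + bilin Q (coef_row N h2 *m J) (coef_row N h2 *m J)
      + (\tr (S *m X' *m Q *m X^T) + \tr (S *m X *m Q *m X'^T)).
  have [] := jetP dN X f; set J := _ + _ => hJ dJ tJ /=.
  have := trace_storage S Q J; rewrite -SE hJ tJ => <-.
  pose T (M : 'M[R]_N.+1) := \tr (M *m J *m Q *m J^T).
  have TD M1 M2 : T (M1 + M2) = T M1 + T M2 by rewrite /T !mulmxDl raddfD.
  have TN M1 : T (- M1) = - T M1 by rewrite /T !mulNmx raddfN.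
  have TZ c M1 : T (c *: M1) = c * T M1 by rewrite /T -!scalemxAl mxtraceZ.
  have T1 (u v : 'rV[R]_N.+1) : T (u^T *m v) = bilin Q (v *m J) (u *m J) by exact: trace_rank1.
  by rewrite -/(T _) !(TD, TN, TZ) !T1 dJ; ring.
split => // Qpsd; apply: (lyapunov_ge0 (A := companion_mx N d)).
  exact: hurwitz_companion.
move=> X; have /= := diss X 0; rewrite !mulmx0 !addr0.
have f0 u : bilin Q 0 u = 0 by rewrite /bilin !mul0mx mxE.
have f0' u : bilin Q u 0 = 0 by rewrite /bilin trmx0 mulmx0 mxE.
rewrite !f0 !f0' !addr0 !mulr0 !add0r => E.
have := Qpsd (coef_row N h1 *m (jet_lift N d *m X)).
have := Qpsd (coef_row N h2 *m (jet_lift N d *m X)).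
have := mulr_le0_ge0 r0 (Qpsd (coef_row N n *m (jet_lift N d *m X))).
rewrite E; lra.
Qed.

End StorageFunction.

(** * Calculus of primitives *)
Section Primitives.
Variable R : realType.
Local Notation mu := (@lebesgue_measure R).
Implicit Types (f g F G : R -> R) (t T : R).

Definition prefix_integrable f := forall T, 0 <= T -> mu.-integrable `[0, T] (EFin \o f).

Lemma integrable_scale (D : set R) (c : R) f : measurable D ->
  mu.-integrable D (EFin \o f) -> mu.-integrable D (EFin \o (fun x => c * f x)).
Proof.
move=> mD intf; rewrite (_ : EFin \o _ = (fun x => c%:E * (EFin \o f) x)%E) //.
exact: integrableZl.
Qed.

Lemma measurable_triangle : measurable [set z : R * R | z.1 < z.2].
Proof.
have -> : [set z : R * R | z.1 < z.2] = setT `&` (fun z : R * R => z.1 < z.2) @^-1` [set true].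
  by rewrite setTI; apply/seteqP; split => z.
by apply: measurable_fun_ltr.
Qed.

(** Fubini's theorem for f x * g y on the triangle 0 <= x < y <= t. *)
Lemma Rintegral_triangle f g t : mu.-integrable `[0, t] (EFin \o f) ->
  mu.-integrable `[0, t] (EFin \o g) ->
  \int[mu]_(x in `[0, t]) (f x * \int[mu]_(y in `]x, t]) g y) =
  \int[mu]_(y in `[0, t]) (g y * \int[mu]_(x in `[0, y[) f x).
Proof.
move=> intf intg.
pose f1 := f \_ `[0, t]; pose g1 := g \_ `[0, t].
have if1 : mu.-integrable setT (EFin \o f1).
  by rewrite /f1 -restrict_EFin; apply/integrable_restrict => //=; rewrite setTI.
have ig1 : mu.-integrable setT (EFin \o g1).
  by rewrite /g1 -restrict_EFin; apply/integrable_restrict => //=; rewrite setTI.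
pose h (z : R * R) := f1 z.1 * g1 z.2.
pose k (z : R * R) := h z * \1_[set z : R * R | z.1 < z.2] z.
have tri (x y : R) : ((x, y) \in [set z : R * R | z.1 < z.2]) = (x < y).
  by apply/idP/idP => [/set_mem|xy] //; apply/mem_set.
have p0R : (point : R) = 0 by [].
have p0E : (point : \bar R) = 0%E by [].
pose Lf (x : R) := f x * \int[mu]_(y in `]x, t]) g y.
pose Rf (y : R) := g y * \int[mu]_(x in `[0, y[) f x.
have LE x : (\int[mu]_y (EFin \o k) (x, y))%E = ((EFin \o Lf) \_ `[0, t]) x.
  rewrite patchE; case: ifPn => [|xt]; last first.
    rewrite integral0_eq // => y _; rewrite /= /k /h /f1 patchE (negPf xt) !mul0r //.
  rewrite inE /= in_itv /= => /andP[x0 xt].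
  have igx : mu.-integrable `]x, t] (EFin \o g).
    by apply: integrableS intg => //; apply: subset_itvr; rewrite bnd_simp.
  transitivity (\int[mu]_(y in `]x, t]) (f x * g y)%:E)%E.
    rewrite [RHS]integral_mkcond; apply: eq_integral => y _.
    rewrite /= /k /h /f1 /g1 !patchE mem_set ?mulr1; last by rewrite /= in_itv /= x0.
    rewrite indicE tri !mem_setE !in_itv /= p0R p0E.
    case: (ltP x y) => [xy|yx] /=; last by rewrite mulr0.
    by rewrite (le_trans x0 (ltW xy)) /= mulr1; case: (y <= t); rewrite ?mulr0.
  rewrite -[LHS]fineK; last first.
    by apply: integrable_fin_num => //; exact: integrable_scale.
  by congr EFin; rewrite /Lf -RintegralZl.
have RE y : (\int[mu]_x (EFin \o k) (x, y))%E = ((EFin \o Rf) \_ `[0, t]) y.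
  rewrite patchE; case: ifPn => [|yt]; last first.
    rewrite integral0_eq // => x _; rewrite /= /k /h /g1 patchE (negPf yt) mulr0 !mul0r //.
  rewrite inE /= in_itv /= => /andP[y0 yt].
  have ify : mu.-integrable `[0, y[ (EFin \o f).
    by apply: integrableS intf => //; apply: subset_itvl; rewrite bnd_simp.
  transitivity (\int[mu]_(x in `[0%R, y[) (g y * f x)%:E)%E.
    rewrite [RHS]integral_mkcond; apply: eq_integral => x _.
    rewrite /= /k /h /f1 /g1 !patchE (mem_set (_ : `[0, t]%classic y)); last by rewrite /= in_itv /= y0.
    rewrite indicE tri !mem_setE !in_itv /= p0R p0E.
    case: (ltP x y) => [xy|yx] /=; last by rewrite mulr0 andbF.
    by rewrite andbT (le_trans (ltW xy) yt) andbT mulr1; case: (0 <= x); rewrite ?mul0r 1?mulrC.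
  rewrite -[LHS]fineK; last first.
    by apply: integrable_fin_num => //; exact: integrable_scale.
  by congr EFin; rewrite /Rf -RintegralZl.
have mf1 : measurable_fun setT f1 by apply/measurable_EFinP; apply: measurable_int if1.
have mg1 : measurable_fun setT g1 by apply/measurable_EFinP; apply: measurable_int ig1.
have mh : measurable_fun setT h.
  apply: measurable_funM; apply: measurableT_comp => //.
have mk : measurable_fun setT k.
  by apply: measurable_funM => //; apply: measurable_indic; exact: measurable_triangle.
have ih : (mu \x mu)%E.-integrable setT (EFin \o h).
  apply/integrable12ltyP; first exact/measurable_EFinP.
  have hE x : (\int[mu]_y `|(EFin \o h) (x, y)| = `|f1 x|%:E * \int[mu]_y `|g1 y|%:E)%E.
    rewrite -ge0_integralZl //; last by do 2 apply: measurableT_comp => //.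
    by apply: eq_integral => y _; rewrite /h /= normrM EFinM.
  under eq_integral do rewrite hE.
  have /integrableP[_ gy] := ig1; have /integrableP[_ fy] := if1.
  rewrite ge0_integralZr //; first last.
  - by apply: integral_ge0 => y _; rewrite lee_fin.
  - by do 2 apply: measurableT_comp => //.
  - have f0 : (0 <= \int[mu]_x `|f1 x|%:E)%E by apply: integral_ge0 => y _; rewrite lee_fin.
    by apply: lte_mul_pinfty => //; rewrite ge0_fin_numE.
have ik : (mu \x mu)%E.-integrable setT (EFin \o k).
  apply: (le_integrable _ _ _ ih) => //; first exact/measurable_EFinP.
  move=> z _; rewrite /= lee_fin /k normrM ler_piMr //.
  by rewrite indicE; case: (_ \in _); rewrite ?normr1 ?normr0.
have fub := Fubini ik.
move: fub; under eq_integral do rewrite LE; under [in RHS]eq_integral do rewrite RE.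
by rewrite -!integral_mkcond /Rintegral => ->.
Qed.

End Primitives.

Section PrimitiveCalculus.
Variable R : realType.
Local Notation mu := (@lebesgue_measure R).
Implicit Types (f g F G : R -> R) (t T : R).

(** Only the integrated form of F' = f is available for the state of a system
    with a locally integrable input. *)
Definition primitive F f := prefix_integrable f /\
  forall t, 0 <= t -> F t = F 0 + \int[mu]_(x in `[0, t]) f x.

Lemma in_prefix t T : (t \in `[0, T]%classic) = (0 <= t <= T).
Proof. by rewrite mem_setE in_itv. Qed.

Lemma prefix_integrable_ext f g : (forall t, 0 <= t -> f t = g t) ->
  prefix_integrable f -> prefix_integrable g.
Proof.
move=> fg hf T T0; apply: eq_integrable (hf T T0) => // x; rewrite in_prefix => /andP[x0 _].
by rewrite /= fg.
Qed.

Lemma prefix_integrableD f g : prefix_integrable f -> prefix_integrable g ->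
  prefix_integrable (fun t => f t + g t).
Proof.
move=> hf hg T T0; rewrite (_ : EFin \o _ = ((EFin \o f) \+ (EFin \o g))%E) //.
by apply: integrableD => //; [exact: hf|exact: hg].
Qed.

Lemma prefix_integrableZ c f : prefix_integrable f ->
  prefix_integrable (fun t => c * f t).
Proof. by move=> hf T T0; apply: integrable_scale => //; exact: hf. Qed.

Definition prefix_bounded f := forall T, 0 <= T ->
  measurable_fun `[0, T] f /\ exists M, forall t, 0 <= t <= T -> `|f t| <= M.

Lemma prefix_integrable_mul f g : prefix_bounded f -> prefix_integrable g ->
  prefix_integrable (fun t => f t * g t).
Proof.
move=> bf hg T T0; have [mf [M hM]] := bf T T0.
rewrite (_ : EFin \o _ = (EFin \o f) \* (EFin \o g))%E //.
apply: integrableMr => //; last exact: hg.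
exists M; split; first exact: num_real.
move=> x Mx y; rewrite /= in_itv /= => y0T; exact: le_trans (hM y y0T) (ltW Mx).
Qed.

Lemma prefix_bounded_integrable f : prefix_bounded f -> prefix_integrable f.
Proof.
move=> bf; have : prefix_integrable (fun t => f t * 1).
  apply: prefix_integrable_mul => // T T0.
  apply: measurable_bounded_integrable => //; last first.
    exists 1; split; first exact: num_real.
    by move=> x x1 y _ /=; rewrite normr1 ltW.
  by apply: compact_finite_measure; exact: segment_compact.
by apply: prefix_integrable_ext => t _; rewrite mulr1.
Qed.

Lemma continuous_prefix_bounded f : {within `[0, +oo[, continuous f} -> prefix_bounded f.
Proof.
move=> cf T T0.
have cT : {within `[0, T], continuous f}.
  apply: continuous_subspaceW cf => x; rewrite /= !in_itv /= => /andP[-> _] //.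
split; first by apply: subspace_continuous_measurable_fun.
have /compact_bounded[M [_ hM]] := continuous_compact cT (@segment_compact R 0 T).
exists (M + 1) => t tT; apply: (hM (M + 1)); first by rewrite ltrDl.
by exists t => //=; rewrite in_itv.
Qed.

Lemma primitive_prefix_bounded F f : primitive F f -> prefix_bounded F.
Proof.
move=> [hf FE] T T0; split; last first.
  exists (`|F 0| + \int[mu]_(x in `[0, T]) `|f x|) => t /andP[t0 tT].
  rewrite FE // (le_trans (ler_normD _ _)) // lerD2l.
  apply: le_trans (le_normr_Rintegral _ (hf t t0)) _ => //.
  have ifT := integrable_norm (hf T T0); have ift := integrable_norm (hf t t0).
  rewrite -subr_ge0 Rintegral_itvB ?bnd_simp //; first exact: Rintegral_ge0.
apply: (eq_measurable_fun (fun t => F 0 + \int[mu]_(x in `[0, t]) f x)).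
  by move=> t; rewrite in_prefix => /andP[t0 _]; rewrite [RHS]FE.
apply: measurable_funD => //; apply: subspace_continuous_measurable_fun => //.
exact: parameterized_integral_continuous T0 (hf T T0).
Qed.

Lemma primitive_ext F G f g : primitive F f -> (forall t, 0 <= t -> F t = G t) ->
  (forall t, 0 <= t -> f t = g t) -> primitive G g.
Proof.
move=> [hf FE] FG fg; split; first exact: prefix_integrable_ext fg hf.
move=> t t0; rewrite -!FG // FE //; congr (_ + _); apply: eq_Rintegral => x.
by rewrite in_prefix => /andP[x0 _]; exact: fg.
Qed.

Lemma primitive_cst c : primitive (fun=> c) (fun=> 0).
Proof.
split=> [T T0|t t0]; first exact: integrable0.
by rewrite Rintegral_cst // mul0r addr0.
Qed.

Lemma primitiveD F G f g : primitive F f -> primitive G g ->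
  primitive (fun t => F t + G t) (fun t => f t + g t).
Proof.
move=> [hf FE] [hg GE]; split; first exact: prefix_integrableD.
move=> t t0; rewrite RintegralD //; [|exact: hf|exact: hg].
by rewrite (FE t t0) (GE t t0) addrACA.
Qed.

(** In the integral of f G write G x = G t - (integral of g over ]x, t]), and in
    that of F g write F y = F 0 + (integral of f over [0, y[); the two double
    integrals over the triangle cancel. *)
Lemma primitiveM F G f g : primitive F f -> primitive G g ->
  primitive (fun t => F t * G t) (fun t => f t * G t + F t * g t).
Proof.
move=> pF pG; have [hf FE] := pF; have [hg GE] := pG.
have bF := primitive_prefix_bounded pF; have bG := primitive_prefix_bounded pG.
have hfG : prefix_integrable (fun t => f t * G t).
  by apply: prefix_integrable_ext (prefix_integrable_mul bG hf) => t _; rewrite mulrC.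
have hFg := prefix_integrable_mul bF hg.
split; first exact: prefix_integrableD.
move=> t t0; have ift := hf t t0; have igt := hg t t0.
rewrite RintegralD //; [|exact: hfG|exact: hFg].
have tail x : 0 <= x <= t -> \int[mu]_(y in `]x, t]) g y = G t - G x.
  move=> /andP[x0 xt]; rewrite -(@Rintegral_itvB _ _ _ _ x igt) ?bnd_simp //.
  rewrite (GE t t0) (GE x x0); ring.
have head y : 0 <= y <= t -> \int[mu]_(x in `[0, y[) f x = F y - F 0.
  move=> /andP[y0 yt]; rewrite Rintegral_itv_bndo_bndc.
    by rewrite (FE y y0) addrAC subrr add0r.
  by apply: integrableS ift => //; apply: subset_itvl; rewrite bnd_simp.
have := Rintegral_triangle ift igt.
have -> : \int[mu]_(x in `[0, t]) (f x * \int[mu]_(y in `]x, t]) g y) =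
    \int[mu]_(x in `[0, t]) (G t * f x - f x * G x).
  by apply: eq_Rintegral => x; rewrite in_prefix => xt; rewrite tail //; ring.
have -> : \int[mu]_(y in `[0, t]) (g y * \int[mu]_(x in `[0, y[) f x) =
    \int[mu]_(y in `[0, t]) (F y * g y - F 0 * g y).
  by apply: eq_Rintegral => x; rewrite in_prefix => xt; rewrite head //; ring.
rewrite !RintegralB ?RintegralZl //; [|exact: hFg|exact: integrable_scale|exact: integrable_scale|exact: hfG].
rewrite (FE t t0) (GE t t0); lra.
Qed.

Lemma primitive_sum (I : finType) (F f : I -> R -> R) :
  (forall i, primitive (F i) (f i)) ->
  primitive (fun t => \sum_i F i t) (fun t => \sum_i f i t).
Proof.
move=> h; elim: index_enum => [|i s IH].
  by apply: primitive_ext (primitive_cst 0) _ _ => t _; rewrite big_nil.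
by apply: primitive_ext (primitiveD (h i) IH) _ _ => t _; rewrite big_cons.
Qed.

Lemma primitive_derive F f : (forall t, is_derive t 1 F (f t)) -> continuous f ->
  primitive F f.
Proof.
move=> dF cf.
have cF : continuous F.
  by move=> t; apply: differentiable_continuous; apply/derivable1_diffP; have [] := dF t.
split.
  apply: prefix_bounded_integrable; apply: continuous_prefix_bounded.
  exact: continuous_subspaceT.
move=> t; rewrite le_eqVlt => /orP[/eqP <-|t0].
  by rewrite set_itv1 Rintegral_set1 addr0.
have -> : \int[mu]_(x in `[0, t]) f x = F t - F 0; last by rewrite addrC subrK.
rewrite /Rintegral (@continuous_FTC2 R f F 0 t t0) //=.
- exact: continuous_subspaceT.
- split => //.
  + by apply: cvg_at_right_filter; exact: cF.
  + by apply: cvg_at_left_filter; exact: cF.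
- by move=> x _; rewrite derive1E; have [_ ->] := dF x.
Qed.

End PrimitiveCalculus.

(** * Matrix exponential and linear differential equations *)
Section MatrixExponential.
Variable R : realType.

Lemma mx_pow_bound n (A : 'M[R]_n) :
  exists2 C, 0 <= C & forall p i j, `|(A ^+ p) i j| <= C ^+ p.
Proof.
pose C := \sum_i \sum_j `|A i j|.
have C0 : 0 <= C by do 2 (apply: sumr_ge0 => ? _).
exists C => //; elim=> [|p IH] i j.
  by rewrite expr0 mxE; case: (_ == _); rewrite ?normr1 ?normr0.
rewrite exprS mxE (le_trans (ler_norm_sum _ _ _)) //.
apply: (@le_trans _ _ (\sum_l `|A i l| * C ^+ p)).
  by apply: ler_sum => l _; rewrite normrM ler_wpM2l.
rewrite -mulr_suml exprS ler_wpM2r ?exprn_ge0 //.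
by rewrite /C [leRHS](bigD1 i) //= lerDl; do 2 (apply: sumr_ge0 => ? _).
Qed.

(** The power series of t |-> M exp(t A) B entry by entry.  The outer factors
    make the family stable under differentiation, which replaces M by M A. *)
Definition exp_coef m n p (M : 'M[R]_(m, n)) (A : 'M[R]_n) (B : 'M[R]_(n, p)) i j : R^nat :=
  fun l => (M *m A ^+ l *m B) i j / l`!%:R.

Lemma exp_coef_diffs m n p (M : 'M[R]_(m, n)) (A : 'M[R]_n) (B : 'M[R]_(n, p)) i j :
  pseries_diffs (exp_coef M A B i j) = exp_coef (M *m A) A B i j.
Proof.
apply/funext => l; rewrite /pseries_diffs /exp_coef factS natrM exprS -[A * _]/(A *m _) !mulmxA.
by rewrite invfM mulrCA mulVKf // pnatr_eq0.
Qed.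

Lemma cvg_exp_coef m n p (M : 'M[R]_(m, n)) (A : 'M[R]_n) (B : 'M[R]_(n, p)) i j t :
  cvgn (pseries (exp_coef M A B i j) t).
Proof.
have [C C0 hC] := mx_pow_bound A.
pose K := \sum_a \sum_b `|M i a| * `|B b j|.
have K0 : 0 <= K by do 2 (apply: sumr_ge0 => ? _); rewrite mulr_ge0.
have bnd l : `|(M *m A ^+ l *m B) i j| <= K * C ^+ l.
  have -> : (M *m A ^+ l *m B) i j = \sum_a \sum_b M i a * (A ^+ l) a b * B b j.
    rewrite exchange_big mxE; apply: eq_bigr => b _ /=.
    by rewrite mxE mulr_suml.
  rewrite (le_trans (ler_norm_sum _ _ _)) // /K mulr_suml ler_sum // => a _.
  rewrite (le_trans (ler_norm_sum _ _ _)) // mulr_suml ler_sum // => b _.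
  by rewrite !normrM mulrAC ler_wpM2l // mulr_ge0.
apply: normed_cvg; apply: (@series_le_cvg _ _ (fun l => K * exp_coeff (C * `|t|) l)).
- by move=> l /=.
- by move=> l; rewrite /exp_coeff mulr_ge0 // mulr_ge0 ?invr_ge0 // exprn_ge0 // mulr_ge0.
- move=> l; rewrite /exp_coef /exp_coeff /= !normrM normfV normr_nat normrX exprMn.
  rewrite [leLHS]mulrAC !mulrA ler_wpM2r ?invr_ge0 // ler_wpM2r ?exprn_ge0 //.
- by apply: (is_cvg_seriesZ (k := K)); exact: is_cvg_series_exp_coeff.
Qed.

Lemma mul_expmxE m n p (M : 'M[R]_(m, n)) (A : 'M[R]_n) (B : 'M[R]_(n, p)) i j t :
  (M *m expmx (t *: A) *m B) i j = limn (pseries (exp_coef M A B i j) t).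
Proof.
have expZ l : (t *: A) ^+ l = t ^+ l *: A ^+ l.
  elim: l => [|l IH]; first by rewrite !expr0 scale1r.
  by rewrite !exprS IH -[_ * _]/(_ *m _) -scalemxAl -scalemxAr scalerA.
have ent a b : (fun k => (\matrix_(a, b) series (fun l => ((t *: A) ^+ l) a b / l`!%:R) k) a b)
    @ \oo --> (expmx (t *: A) a b : R).
  under eq_fun do rewrite mxE.
  rewrite mxE; have := @cvg_exp_coef _ _ _ 1%:M A 1%:M a b t.
  rewrite /pseries (_ : (fun n0 => _) = (fun l => ((t *: A) ^+ l) a b / l`!%:R)) //.
  by apply/funext => l; rewrite /exp_coef mul1mx mulmx1 expZ mxE; ring.
apply/esym/cvg_lim; first exact: Rhausdorff.
have cst a b (N : 'M[R]_(a, b)) x y : (fun k : nat => N x y) @ \oo --> (N x y : R) by exact: cvg_cst.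
have := @mx_mul_cvg _ _ _ _ _ _ _ _ (@mx_mul_cvg _ _ _ _ _ _ _ _ (cst _ _ M) ent) (cst _ _ B) i j.
apply: cvg_trans; apply: near_eq_cvg; apply: nearW => k.
rewrite /pseries /series /= mxE.
have -> : (\sum_(0 <= l < k) exp_coef M A B i j l * t ^+ l) =
    \sum_(0 <= l < k) \sum_b \sum_a M i a * (((t *: A) ^+ l) a b / l`!%:R) * B b j.
  apply: eq_bigr => l _; rewrite /exp_coef mxE !mulr_suml; apply: eq_bigr => b _.
  rewrite mxE !mulr_suml; apply: eq_bigr => a _; have -> : ((t *: A) ^+ l) a b = t ^+ l * (A ^+ l) a b by rewrite expZ mxE.
  ring.
rewrite exchange_big /=; apply: eq_bigr => b _; rewrite mxE mulr_suml exchange_big /=.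
by apply: eq_bigr => a _; rewrite mxE mulr_sumr mulr_suml.
Qed.

Lemma is_derive_expmx m n p (M : 'M[R]_(m, n)) (A : 'M[R]_n) (B : 'M[R]_(n, p)) i j t :
  is_derive (t : R) (1 : R) (fun t : R => (M *m expmx (t *: A) *m B) i j)
    ((M *m A *m expmx (t *: A) *m B) i j).
Proof.
rewrite mul_expmxE -exp_coef_diffs.
under eq_fun do rewrite mul_expmxE.
apply: (@pseries_snd_diffs _ _ (`|t| + 1)); rewrite ?exp_coef_diffs; try exact: cvg_exp_coef.
by rewrite [ltRHS]ger0_norm ?addr_ge0 // ltrDl.
Qed.

Lemma expmx_comm n (A : 'M[R]_n) t : A *m expmx (t *: A) = expmx (t *: A) *m A.
Proof.
apply/matrixP => i j; rewrite -[in LHS](mulmx1 (A *m _)) -[in RHS](mul1mx (expmx _)) !mul_expmxE.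
congr (limn (pseries _ _)); apply/funext => l; rewrite /exp_coef mulmx1 mul1mx.
have -> : A *m A ^+ l = A ^+ l *m A by rewrite -[LHS]/(A * _) -[RHS]/(_ * A) -exprS -exprSr.
by [].
Qed.

Lemma expmx0 n : expmx (0 : 'M[R]_n) = 1%:M.
Proof.
apply/matrixP => i j; rewrite mxE; apply: cvg_lim; first exact: Rhausdorff.
apply: cvg_near_cst; near=> k.
have [l ->] : exists l, k = l.+1 by exists k.-1; rewrite prednK //; near: k; exists 1%N.
rewrite /series /= big_nat_recl // expr0 fact0 divr1 big1 ?addr0 // => l' _.
by rewrite expr0n /= mxE mul0r.
Unshelve. all: by end_near. Qed.

End MatrixExponential.

Section LinearODE.
Variable R : realType.
Local Notation mu := (@lebesgue_measure R).

Definition mprimitive m n (F f : R -> 'M[R]_(m, n)) :=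
  forall i j, primitive (fun t => F t i j) (fun t => f t i j).

Lemma mprimitive_ext m n (F G f g : R -> 'M[R]_(m, n)) : mprimitive F f ->
  (forall t, 0 <= t -> F t = G t) -> (forall t, 0 <= t -> f t = g t) -> mprimitive G g.
Proof.
move=> h FG fg i j; apply: primitive_ext (h i j) _ _ => t t0; by rewrite ?FG ?fg.
Qed.

Lemma mprimitive_cst m n (M : 'M[R]_(m, n)) : mprimitive (fun=> M) (fun=> 0).
Proof. by move=> i j; apply: primitive_ext (primitive_cst (M i j)) _ _ => t _; rewrite ?mxE. Qed.

Lemma mprimitiveD m n (F G f g : R -> 'M[R]_(m, n)) : mprimitive F f -> mprimitive G g ->
  mprimitive (fun t => F t + G t) (fun t => f t + g t).
Proof.
by move=> hF hG i j; apply: primitive_ext (primitiveD (hF i j) (hG i j)) _ _ => t _; rewrite mxE.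
Qed.

Lemma mprimitiveM m n p (F f : R -> 'M[R]_(m, n)) (G g : R -> 'M[R]_(n, p)) :
  mprimitive F f -> mprimitive G g ->
  mprimitive (fun t => F t *m G t) (fun t => f t *m G t + F t *m g t).
Proof.
move=> hF hG i j.
apply: primitive_ext (primitive_sum (fun l => primitiveM (hF i l) (hG l j))) _ _ => t _.
  by rewrite mxE.
by rewrite !mxE big_split.
Qed.

Lemma mprimitiveMl m n p (M : 'M[R]_(m, n)) (F f : R -> 'M[R]_(n, p)) :
  mprimitive F f -> mprimitive (fun t => M *m F t) (fun t => M *m f t).
Proof.
move=> hF; apply: mprimitive_ext (mprimitiveM (mprimitive_cst M) hF) _ _ => // t _.
by rewrite mul0mx add0r.
Qed.

Lemma mprimitiveMr m n p (M : 'M[R]_(n, p)) (F f : R -> 'M[R]_(m, n)) :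
  mprimitive F f -> mprimitive (fun t => F t *m M) (fun t => f t *m M).
Proof.
move=> hF; apply: mprimitive_ext (mprimitiveM hF (mprimitive_cst M)) _ _ => // t _.
by rewrite mulmx0 addr0.
Qed.

Lemma mprimitiveT m n (F f : R -> 'M[R]_(m, n)) :
  mprimitive F f -> mprimitive (fun t => (F t)^T) (fun t => (f t)^T).
Proof. by move=> hF i j; apply: primitive_ext (hF j i) _ _ => t _; rewrite mxE. Qed.

Lemma mprimitiveB m n (F G f g : R -> 'M[R]_(m, n)) : mprimitive F f -> mprimitive G g ->
  mprimitive (fun t => F t - G t) (fun t => f t - g t).
Proof.
move=> hF hG; apply: mprimitive_ext (mprimitiveD hF (mprimitiveMl (- 1%:M) hG)) _ _ => t _;
  by rewrite mulNmx mul1mx.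
Qed.

Lemma mprimitive_lsubmx m n p (F f : R -> 'M[R]_(m, n + p)) : mprimitive F f ->
  mprimitive (fun t => lsubmx (F t)) (fun t => lsubmx (f t)).
Proof. by move=> h i j; apply: primitive_ext (h i (lshift p j)) _ _ => t _; rewrite mxE. Qed.

Lemma mprimitive_rsubmx m n p (F f : R -> 'M[R]_(m, n + p)) : mprimitive F f ->
  mprimitive (fun t => rsubmx (F t)) (fun t => rsubmx (f t)).
Proof. by move=> h i j; apply: primitive_ext (h i (rshift n j)) _ _ => t _; rewrite mxE. Qed.

Lemma mprimitive_usubmx m n p (F f : R -> 'M[R]_(m + n, p)) : mprimitive F f ->
  mprimitive (fun t => usubmx (F t)) (fun t => usubmx (f t)).
Proof. by move=> h i j; apply: primitive_ext (h (lshift n i) j) _ _ => t _; rewrite mxE. Qed.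

Lemma mprimitive_dsubmx m n p (F f : R -> 'M[R]_(m + n, p)) : mprimitive F f ->
  mprimitive (fun t => dsubmx (F t)) (fun t => dsubmx (f t)).
Proof. by move=> h i j; apply: primitive_ext (h (rshift m i) j) _ _ => t _; rewrite mxE. Qed.

Lemma mprimitive_eq0 m n (F f : R -> 'M[R]_(m, n)) : mprimitive F f ->
  (forall t, 0 <= t -> f t = 0) -> forall t, 0 <= t -> F t = F 0.
Proof.
move=> hF f0 t t0; apply/matrixP => i j; have [_ ->] := hF i j => //.
rewrite (_ : \int[mu]_(x in _) _ = 0) ?addr0 //.
rewrite (@eq_Rintegral _ _ _ mu _ (fun=> 0)); first by rewrite Rintegral_cst // mul0r.
by move=> x; rewrite in_prefix => /andP[x0 _]; rewrite f0 // mxE.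
Qed.

Lemma mprimitive_expmx n (A : 'M[R]_n) (s : R) :
  mprimitive (fun t => expmx ((t + s) *: A)) (fun t => A *m expmx ((t + s) *: A)).
Proof.
have D M i j t : is_derive (t : R) (1 : R) (fun t : R => (M *m expmx (t *: A) : 'M[R]_n) i j)
    ((M *m A *m expmx (t *: A)) i j).
  have := is_derive_expmx M A 1%:M i j t; rewrite mulmx1.
  by under eq_fun do rewrite mulmx1.
have Ds M i j t : is_derive (t : R) (1 : R) (fun t : R => (M *m expmx ((t + s) *: A) : 'M[R]_n) i j)
    ((M *m A *m expmx ((t + s) *: A)) i j).
  rewrite -[X in is_derive _ _ _ X]mulr1.
  apply: (@is_derive1_comp _ (fun t : R => (M *m expmx (t *: A)) i j) (fun t => t + s)).
  by rewrite -[X in is_derive _ _ _ X]addr0; apply: is_deriveD.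
move=> i j; have := Ds 1%:M i j; rewrite mul1mx.
under eq_fun do rewrite mul1mx.
move=> h; apply: primitive_derive => // t; apply: differentiable_continuous.
by apply/derivable1_diffP; have [] := Ds A i j t.
Qed.

Lemma mprimitive_expmxN n (A : 'M[R]_n) :
  mprimitive (fun t => expmx (t *: - A)) (fun t => - (expmx (t *: - A) *m A)).
Proof.
apply: mprimitive_ext (mprimitive_expmx (- A) 0) _ _ => t _; rewrite addr0 //.
by rewrite expmx_comm mulmxN.
Qed.

(** The left-hand side has zero derivative in t. *)
Lemma expmxN_mul n (A : 'M[R]_n) t s : 0 <= t ->
  expmx (t *: - A) *m expmx ((t + s) *: A) = expmx (s *: A).
Proof.
move=> t0; rewrite (mprimitive_eq0 (mprimitiveM (mprimitive_expmxN A) (mprimitive_expmx A s))) //.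
  by rewrite scale0r add0r expmx0 mul1mx.
by move=> x _; rewrite mulNmx mulmxA addNr.
Qed.

Lemma expmx_mulN n (A : 'M[R]_n) t : 0 <= t -> expmx (t *: A) *m expmx (t *: - A) = 1%:M.
Proof. by move=> t0; apply: mulmx1C; rewrite -{2}[t]addr0 expmxN_mul // scale0r expmx0. Qed.

Lemma expmx_sub n (A : 'M[R]_n) t s : 0 <= s <= t ->
  expmx ((t - s) *: A) = expmx (t *: A) *m expmx (s *: - A).
Proof.
move=> /andP[s0 st].
have E : expmx (t *: A) = expmx ((t - s) *: A) *m expmx (s *: A).
  have ts0 : 0 <= t - s by rewrite subr_ge0.
  by rewrite -(expmxN_mul A s ts0) subrK mulmxA expmx_mulN // mul1mx.
by rewrite E -mulmxA expmx_mulN // mulmx1.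
Qed.

Definition prefix_integrable_mx m n (F : R -> 'M[R]_(m, n)) :=
  forall i j, prefix_integrable (fun t => F t i j).

Lemma prefix_integrable_sum (I : finType) (F : I -> R -> R) :
  (forall i, prefix_integrable (F i)) -> prefix_integrable (fun t => \sum_i F i t).
Proof.
move=> h; elim: index_enum => [|i s IH].
  by apply: (prefix_integrable_ext _ (primitive_cst (0 : R)).1) => t _; rewrite big_nil.
have hi := prefix_integrableD (h i) IH.
by move: hi; apply: prefix_integrable_ext => t _; rewrite big_cons.
Qed.

Lemma Rintegral_lsum (I : finType) (c : I -> R) (F : I -> R -> R) t : 0 <= t ->
  (forall i, prefix_integrable (F i)) ->
  \int[mu]_(x in `[0, t]) (\sum_i c i * F i x) = \sum_i c i * \int[mu]_(x in `[0, t]) F i x.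
Proof.
move=> t0 h; elim: index_enum => [|i s IH].
  rewrite big_nil (@eq_Rintegral _ _ _ mu _ (fun=> 0)); first by rewrite Rintegral_cst // mul0r.
  by move=> x _; rewrite big_nil.
rewrite big_cons -IH -RintegralZl //; last exact: h.
rewrite -RintegralD //.
- by apply: eq_Rintegral => x _; rewrite big_cons.
- by apply: integrable_scale => //; exact: h.
- have hs : prefix_integrable (fun x => \sum_(j <- s) c j * F j x).
    elim: s {IH} => [|j s IH].
      by apply: (prefix_integrable_ext _ (primitive_cst (0 : R)).1) => x _; rewrite big_nil.
    have hj := prefix_integrableZ (c j) (h j).
    by apply: (prefix_integrable_ext _ (prefix_integrableD hj IH)) => x _; rewrite big_cons.
  exact: hs.
Qed.

(** Variation of constants.  The convolution formula links the solution with
    the input-output map of a state-space system. *)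
Lemma linear_ode_solution n m (A : 'M[R]_n) (phi : R -> 'M[R]_(n, m)) :
  prefix_integrable_mx phi ->
  exists X : R -> 'M[R]_(n, m), [/\ mprimitive X (fun t => A *m X t + phi t), X 0 = 0 &
    forall p (C : 'M[R]_(p, n)) t i j, 0 <= t -> (C *m X t) i j =
      \int[mu]_(s in `[0, t]) (C *m expmx ((t - s) *: A) *m phi s) i j].
Proof.
move=> hphi.
have bE : forall i j, prefix_bounded (fun t : R => expmx (t *: - A) i j).
  by move=> i j; exact: primitive_prefix_bounded (mprimitive_expmxN A i j).
have lE : prefix_integrable_mx (fun s => expmx (s *: - A) *m phi s).
  move=> i j; apply: prefix_integrable_ext (prefix_integrable_sum
    (fun l => prefix_integrable_mul (bE i l) (hphi l j))) => s _.
  by rewrite mxE.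
pose Y t : 'M[R]_(n, m) := \matrix_(i, j) \int[mu]_(s in `[0, t]) (expmx (s *: - A) *m phi s) i j.
have Y0 : Y 0 = 0 by apply/matrixP => i j; rewrite !mxE set_itv1 Rintegral_set1.
have pY : mprimitive Y (fun s => expmx (s *: - A) *m phi s).
  by move=> i j; split; [exact: lE|move=> t t0; rewrite Y0 !mxE add0r].
exists (fun t => expmx (t *: A) *m Y t); split.
- have pE : mprimitive (fun t => expmx (t *: A)) (fun t => A *m expmx (t *: A)).
    by apply: mprimitive_ext (mprimitive_expmx A 0) _ _ => t _; rewrite addr0.
  apply: mprimitive_ext (mprimitiveM pE pY) _ _ => // t t0.
  by rewrite !mulmxA expmx_mulN // mul1mx.
- by rewrite Y0 mulmx0.
- move=> p C t i j t0; rewrite mulmxA mxE.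
  under eq_bigr do rewrite [Y _ _ _]mxE.
  rewrite -Rintegral_lsum //.
  apply: eq_Rintegral => s; rewrite in_prefix => st.
  have -> : C *m expmx ((t - s) *: A) *m phi s =
      C *m expmx (t *: A) *m (expmx (s *: - A) *m phi s) by rewrite expmx_sub // !mulmxA.
  by rewrite [RHS]mxE.
Qed.

(** exp(- t A) X t is constant. *)
Lemma linear_ode_unique n m (A : 'M[R]_n) (X : R -> 'M[R]_(n, m)) :
  mprimitive X (fun t => A *m X t) -> X 0 = 0 -> forall t, 0 <= t -> X t = 0.
Proof.
move=> hX X0 t t0.
have : expmx (t *: - A) *m X t = 0.
  rewrite (mprimitive_eq0 (mprimitiveM (mprimitive_expmxN A) hX)) //; first by rewrite X0 mulmx0.
  by move=> x _; rewrite mulNmx mulmxA addNr.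
by move/(congr1 (mulmx (expmx (t *: A)))); rewrite mulmxA expmx_mulN // mul1mx mulmx0.
Qed.

End LinearODE.

(** * Locally square integrable signals *)
Section SquareIntegrable.
Variable R : realType.
Local Notation mu := (@lebesgue_measure R).
Implicit Types f g : R -> R.

Definition square_integrable f := forall T : R, 0 <= T ->
  measurable_fun `[0, T] f /\ mu.-integrable `[0, T] (EFin \o (fun t => f t ^+ 2)).

Lemma square_integrable_mul f g : square_integrable f -> square_integrable g ->
  prefix_integrable (fun t => f t * g t).
Proof.
move=> hf hg T T0; have [mf f2] := hf T T0; have [mg g2] := hg T T0.
apply: le_integrable (integrableD _ f2 g2) => //.
  by apply/measurable_EFinP; apply: measurable_funM.
move=> t _; rewrite /= lee_fin [leRHS]ger0_norm ?addr_ge0 ?sqr_ge0 // normrM.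
rewrite -[f t ^+ 2]real_normK ?num_real // -[g t ^+ 2]real_normK ?num_real //.
have := sqr_ge0 (`|f t| - `|g t|); have := sqr_ge0 (`|f t| + `|g t|); nra.
Qed.

Lemma square_integrableD f g : square_integrable f -> square_integrable g ->
  square_integrable (fun t => f t + g t).
Proof.
move=> hf hg T T0; have [mf f2] := hf T T0; have [mg g2] := hg T T0.
split; first exact: measurable_funD.
have hfg := square_integrable_mul hf hg.
have h2 : prefix_integrable (fun t => f t ^+ 2 + (2 * (f t * g t) + g t ^+ 2)).
  apply: (prefix_integrable_ext (f := fun t => f t * f t + (2 * (f t * g t) + g t * g t))) => //.
  apply: prefix_integrableD; first exact: square_integrable_mul.
  apply: prefix_integrableD; first exact: prefix_integrableZ.
  exact: square_integrable_mul.
by apply: (prefix_integrable_ext _ h2) => // t _; ring.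
Qed.

Lemma prefix_bounded_square_integrable f : prefix_bounded f -> square_integrable f.
Proof.
move=> bf T T0; split; first by have [] := bf T T0.
by apply: prefix_integrable_mul (prefix_bounded_integrable bf) _ _.
Qed.

Lemma square_integrableZ c f : square_integrable f -> square_integrable (fun t => c * f t).
Proof.
move=> hf T T0; have [mf f2] := hf T T0; split; first exact: measurable_funM.
rewrite (_ : (fun t => _) = (fun t => c ^+ 2 * f t ^+ 2)); first exact: integrable_scale.
by apply/funext => t; rewrite exprMn.
Qed.

Lemma square_integrable_integrable f : square_integrable f -> prefix_integrable f.
Proof.
move=> hf; apply: (prefix_integrable_ext (f := fun t => f t * 1)); first by move=> t _; rewrite mulr1.
apply: square_integrable_mul => //; apply: prefix_bounded_square_integrable.
exact: primitive_prefix_bounded (primitive_cst (1 : R)).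
Qed.

Lemma square_integrable_ext f g : (forall t, 0 <= t -> f t = g t) ->
  square_integrable f -> square_integrable g.
Proof.
move=> fg hf T T0; have [mf f2] := hf T T0.
have fgT : {in `[0, T]%classic, f =1 g} by move=> t; rewrite in_prefix => /andP[t0 _]; exact: fg.
split; first exact: eq_measurable_fun mf.
by apply: eq_integrable f2 => // t tT; rewrite /= fgT.
Qed.

Lemma square_integrable_sum (I : finType) (F : I -> R -> R) :
  (forall i, square_integrable (F i)) -> square_integrable (fun t => \sum_i F i t).
Proof.
move=> h; elim: index_enum => [|i s IH].
  apply: (@square_integrable_ext (fun=> 0)); first by move=> t _; rewrite big_nil.
  exact: prefix_bounded_square_integrable (primitive_prefix_bounded (primitive_cst (0 : R))).
by move: (square_integrableD (h i) IH); apply: square_integrable_ext => t _; rewrite big_cons.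
Qed.

Definition square_integrable_mx m n (F : R -> 'M[R]_(m, n)) :=
  forall i j, square_integrable (fun t => F t i j).

Lemma square_integrable_mxMl m n p (A : 'M[R]_(m, n)) (F : R -> 'M[R]_(n, p)) :
  square_integrable_mx F -> square_integrable_mx (fun t => A *m F t).
Proof.
move=> hF i j; move: (square_integrable_sum (fun l => square_integrableZ (A i l) (hF l j))).
by apply: square_integrable_ext => t _; rewrite mxE.
Qed.

Lemma square_integrable_mxD m n (F G : R -> 'M[R]_(m, n)) :
  square_integrable_mx F -> square_integrable_mx G -> square_integrable_mx (fun t => F t + G t).
Proof.
move=> hF hG i j; move: (square_integrableD (hF i j) (hG i j)).
by apply: square_integrable_ext => t _; rewrite mxE.
Qed.

Lemma square_integrable_mxM m n p (F : R -> 'M[R]_(m, n)) (G : R -> 'M[R]_(n, p)) :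
  square_integrable_mx F -> square_integrable_mx G ->
  prefix_integrable_mx (fun t => F t *m G t).
Proof.
move=> hF hG i j; move: (prefix_integrable_sum (fun l => square_integrable_mul (hF i l) (hG l j))).
by apply: prefix_integrable_ext => t _; rewrite mxE.
Qed.

Lemma square_integrable_mxT m n (F : R -> 'M[R]_(m, n)) :
  square_integrable_mx F -> square_integrable_mx (fun t => (F t)^T).
Proof. by move=> hF i j; move: (hF j i); apply: square_integrable_ext => t _; rewrite mxE. Qed.

Lemma square_integrable_mx_col m n p (F : R -> 'M[R]_(m, p)) (G : R -> 'M[R]_(n, p)) :
  square_integrable_mx F -> square_integrable_mx G ->
  square_integrable_mx (fun t => col_mx (F t) (G t)).
Proof.
move=> hF hG i j; case: (split_ordP i) => l ->.
  by move: (hF l j); apply: square_integrable_ext => t _; rewrite col_mxEu.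
by move: (hG l j); apply: square_integrable_ext => t _; rewrite col_mxEd.
Qed.

Lemma square_integrable_mx_ext m n (F G : R -> 'M[R]_(m, n)) :
  (forall t, 0 <= t -> F t = G t) -> square_integrable_mx F -> square_integrable_mx G.
Proof.
by move=> FG hF i j; move: (hF i j); apply: square_integrable_ext => t t0; rewrite FG.
Qed.

Lemma mprimitive_square_integrable m n (F f : R -> 'M[R]_(m, n)) :
  mprimitive F f -> square_integrable_mx F.
Proof.
by move=> hF i j; apply: prefix_bounded_square_integrable; exact: primitive_prefix_bounded (hF i j).
Qed.

Lemma L2e_square_integrable n (z : R -> 'cV[R]_n) : L2e z -> square_integrable_mx z.
Proof.
move=> [mz iz] i j T T0; rewrite ord1; have mT : measurable_fun `[0, T] (fun t => z t i 0).
  apply: measurable_funS (mz i) => // x; rewrite /= !in_itv /= => /andP[-> _] //.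
split => //; apply: le_integrable (iz T T0) => //.
  by apply/measurable_EFinP; apply: measurable_funX.
move=> t _; rewrite /= lee_fin mxE.
have -> : \sum_l (z t)^T 0 l * z t l 0 = \sum_l z t l 0 ^+ 2.
  by apply: eq_bigr => l _; rewrite mxE.
rewrite !ger0_norm ?sqr_ge0 ?sumr_ge0 //; last by move=> l _; rewrite sqr_ge0.
by rewrite (bigD1 i) //= lerDl sumr_ge0 // => l _; rewrite sqr_ge0.
Qed.

Lemma continuous_square_integrable n (xi : R -> 'cV[R]_n) :
  (forall i, {within `[0, +oo[, continuous (fun t => xi t i 0)}) -> square_integrable_mx xi.
Proof.
move=> h i j; rewrite ord1; apply: prefix_bounded_square_integrable.
exact: continuous_prefix_bounded.
Qed.

Lemma filter_state_primitive n k l (J : lti R n k l) (u : R -> 'cV[R]_k) (xi : R -> 'cV[R]_n) :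
  square_integrable_mx u -> filter_state J u xi ->
  mprimitive xi (fun t => ltiA J *m xi t + ltiB J *m u t) /\ xi 0 = 0.
Proof.
move=> su [cxi xiE].
have sxi := continuous_square_integrable cxi.
have xi0 : xi 0 = 0.
  by apply/matrixP => i j; rewrite xiE // !mxE set_itv1 Rintegral_set1.
split => // i j; split.
  apply: square_integrable_integrable.
  exact: (square_integrable_mxD (square_integrable_mxMl (ltiA J) sxi) (square_integrable_mxMl (ltiB J) su)).
by move=> t t0; rewrite xi0 xiE // ord1 !mxE add0r.
Qed.

End SquareIntegrable.

(** * Block structure of the multiplier *)
Section BlockStructure.
Variable R : realType.

Lemma kron2_block m n (q s r : R) (M : 'M[R]_(m, n)) :
  kron2 (mx22 q s r) M = block_mx (q *: M) (s *: M) (s *: M) (r *: M).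
Proof.
have e0 p (i : 'I_p) : cast_ord (esym (mul2n_addn p)) (lshift p i) = mxtens_index (0 : 'I_2, i).
  by apply/val_inj; rewrite /= mul0n add0n.
have e1 p (i : 'I_p) : cast_ord (esym (mul2n_addn p)) (rshift p i) = mxtens_index (1 : 'I_2, i).
  by apply/val_inj; rewrite /= mul1n.
apply/matrixP => i j; rewrite /kron2 castmxE.
case: (split_ordP i) => i' ->; case: (split_ordP j) => j' ->;
  rewrite ?(e0, e1) tensmxE mxE /= ?block_mxEul ?block_mxEur ?block_mxEdl ?block_mxEdr mxE //.
Qed.

Lemma kron2_form m (q s r : R) (M : 'M[R]_m) (a1 a2 b1 b2 : 'cV[R]_m) :
  (col_mx a1 a2)^T *m kron2 (mx22 q s r) M *m col_mx b1 b2 =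
  q *: (a1^T *m M *m b1) + s *: (a1^T *m M *m b2 + a2^T *m M *m b1) + r *: (a2^T *m M *m b2).
Proof.
rewrite kron2_block tr_col_mx mul_row_block mul_row_col -!scalemxAr !mulmxDl -!scalemxAl.
rewrite scalerDr -!addrA; congr (_ + _); rewrite !addrA; congr (_ + _); exact: addrC.
Qed.

Lemma kron2_sym m (q s r : R) (M : 'M[R]_m) : M \is symmetricmx ->
  kron2 (mx22 q s r) M \is symmetricmx.
Proof.
rewrite !is_hermitianmxE !expr0 !scale1r !map_mx_id // => /eqP Ms.
by rewrite kron2_block tr_block_mx !linearZ /= -Ms.
Qed.

Definition lmi_mx n k m (A : 'M[R]_n) (B : 'M[R]_(n, k)) (C : 'M[R]_(m, n)) (D : 'M[R]_(m, k))
    (Y : 'M[R]_n) (M : 'M[R]_m) : 'M[R]_(n + k) :=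
  (block_mx 1%:M 0 A B)^T *m block_mx 0 Y Y 0 *m block_mx 1%:M 0 A B
  + (row_mx C D)^T *m M *m row_mx C D.

(** The bilinear form of the linear matrix inequality: the derivative of
    x^T Y x along x' = A x + B u plus the weighted output y^T M y, polarized. *)
Lemma lmi_form n k m (A : 'M[R]_n) (B : 'M[R]_(n, k)) (C : 'M[R]_(m, n)) (D : 'M[R]_(m, k))
    (Y : 'M[R]_n) (M : 'M[R]_m) (x1 x2 : 'cV[R]_n) (u1 u2 : 'cV[R]_k) :
  (col_mx x1 u1)^T *m lmi_mx A B C D Y M *m col_mx x2 u2 =
  (A *m x1 + B *m u1)^T *m Y *m x2 + x1^T *m Y *m (A *m x2 + B *m u2)
  + (C *m x1 + D *m u1)^T *m M *m (C *m x2 + D *m u2).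
Proof.
rewrite /lmi_mx mulmxDr mulmxDl; congr (_ + _).
  rewrite !mulmxA -trmx_mul mul_block_col mul1mx mul0mx addr0 -[_ *m _ *m col_mx x2 u2]mulmxA.
  rewrite mul_block_col mul1mx mul0mx addr0 tr_col_mx mul_row_block !mulmx0 add0r addr0.
  by rewrite mul_row_col.
by rewrite !mulmxA -trmx_mul mul_row_col -[_ *m _ *m col_mx x2 u2]mulmxA mul_row_col.
Qed.

Lemma diag2M (K : pzRingType) m n p (X : 'M[K]_(m, n)) (Z : 'M[K]_(n, p)) :
  diag2 (X *m Z) = diag2 X *m diag2 Z.
Proof. by rewrite /diag2 mulmx_block !(mulmx0, mul0mx) !addr0 !add0r. Qed.

Lemma diag2D (K : pzRingType) m n (X Z : 'M[K]_(m, n)) : diag2 (X + Z) = diag2 X + diag2 Z.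
Proof. by rewrite /diag2 add_block_mx !addr0. Qed.

Lemma diag2_inv (K : comUnitRingType) n (X : 'M[K]_n) : X \in unitmx ->
  invmx (diag2 X) = diag2 (invmx X).
Proof.
move=> uX; have E : diag2 X *m diag2 (invmx X) = 1%:M.
  by rewrite -diag2M mulmxV // /diag2 -scalar_mx_block.
by have [uD _] := mulmx1_unit E; rewrite -[RHS](mulKmx uD) E mulmx1.
Qed.

Lemma resolvent_diag2 (K : comUnitRingType) n (a : K) (X : 'M[K]_n) : a%:M - X \in unitmx ->
  invmx (a%:M - diag2 X) = diag2 (invmx (a%:M - X)).
Proof.
move=> uX; rewrite -diag2_inv //; congr invmx.
by rewrite /diag2 scalar_mx_block opp_block_mx add_block_mx !oppr0 !addr0.
Qed.

Lemma const_rmx_diag2 a b (X : 'M[R]_(a, b)) : const_rmx (diag2 X) = diag2 (const_rmx X).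
Proof. by rewrite /const_rmx /diag2 map_block_mx !map_const_mx. Qed.

Lemma transfer_diag2 n k l (S : lti R n k l) : transfer (lti_diag2 S) = diag2 (transfer S).
Proof.
rewrite /transfer /= !const_rmx_diag2 resolvent_diag2 -?diag2M -?diag2D //.
pose phi : {rmorphism {poly R} -> {fraction {poly R}}} := @tofrac {poly R}.
by apply: (sub_cmx_unit (phi := phi)) => p; rewrite tofrac_eq0.
Qed.

Lemma RHinf_diag2 m n (X : 'M[{fraction {poly R}}]_(m, n)) : RHinf X -> RHinf (diag2 X).
Proof.
move=> hX; have h0 : ~ pole_oo (0 : {fraction {poly R}}) /\
    forall z : R[i], 0 <= complex.Re z -> ~ pole (0 : {fraction {poly R}}) z.
  rewrite /pole_oo /pole rnum0 size_poly0 ltn0; split => // z _.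
  have := @size_rden0 R; move/eqP/size_poly1P => [c c0 ->].
  by rewrite map_polyC rootC fmorph_eq0 (negPf c0).
move=> i j; rewrite /diag2.
case: (split_ordP i) => i' ->; case: (split_ordP j) => j' ->;
  by rewrite ?block_mxEul ?block_mxEur ?block_mxEdl ?block_mxEdr ?mxE.
Qed.

Lemma diag2_col m n p (X : 'M[R]_(m, n)) (a b : 'M[R]_(n, p)) :
  diag2 X *m col_mx a b = col_mx (X *m a) (X *m b).
Proof. by rewrite /diag2 mul_block_col !mul0mx addr0 add0r. Qed.

(** This is why the terminal cost is P0 \otimes Y: each of the four blocks of P0
    multiplies one polarized value of the form of the linear matrix
    inequality. *)
Lemma supply_form n k m (q s r : R) (A : 'M[R]_n) (B : 'M[R]_(n, k)) (C : 'M[R]_(m, n))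
    (D : 'M[R]_(m, k)) (Y : 'M[R]_n) (M : 'M[R]_m) (x1 x2 : 'cV[R]_n) (z w : 'cV[R]_k) :
  let x := col_mx x1 x2 in let u := col_mx z w in
  let x' := diag2 A *m x + diag2 B *m u in let y := diag2 C *m x + diag2 D *m u in
  let Q := lmi_mx A B C D Y M in
  let f1 := (col_mx x1 z)^T in let f2 := (col_mx x2 w)^T in
  (y^T *m kron2 (mx22 q s r) M *m y) 0 0
    + (x'^T *m kron2 (mx22 q s r) Y *m x + x^T *m kron2 (mx22 q s r) Y *m x') 0 0
  = q * bilin Q f1 f1 + s * (bilin Q f1 f2 + bilin Q f2 f1) + r * bilin Q f2 f2.
Proof.
rewrite /= !diag2_col !add_col_mx !kron2_form /bilin !trmxK !lmi_form.
have eD (a b : 'M[R]_1) : (a + b) 0 0 = a 0 0 + b 0 0 by rewrite mxE.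
have eZ e (a : 'M[R]_1) : (e *: a) 0 0 = e * a 0 0 by rewrite mxE.
rewrite !(eD, eZ); ring.
Qed.

Lemma posdefmx_bilin_ge0 n (Q : 'M[R]_n) : posdefmx Q -> forall u, 0 <= bilin Q u u.
Proof.
move=> [_ Qpos] u; have [->|u0] := eqVneq u 0; first by rewrite /bilin !mul0mx mxE.
have := Qpos u^T; rewrite trmxK => /(_ _)/ltW; apply.
by apply: contra_neq u0 => /(congr1 trmx); rewrite trmxK trmx0.
Qed.

End BlockStructure.

(** * The uncertainty commutes with the filter *)
Section FilterCommutation.
Variable R : realType.
Local Notation mu := (@lebesgue_measure R).

(** Equal Markov parameters give equal exponential series, so that the kernel
    of the convolution is a multiple of the identity. *)
Lemma io_map_scalar nD k (Delta : lti R nD k k) N (c : 'rV[R]_N) (a : 'M[R]_N) (b : 'cV[R]_N) D0 :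
  ltiD Delta = D0%:M ->
  (forall p, ltiC Delta *m ltiA Delta ^+ p *m ltiB Delta = ((c *m a ^+ p *m b) 0 0)%:M) ->
  forall (z : R -> 'cV[R]_k) t i, io_map Delta z t i 0 =
    \int[mu]_(s in `[0, t]) (c *m expmx ((t - s) *: a) *m b *m (z s)^T) 0 i + D0 * z t i 0.
Proof.
move=> DE mk z t i.
have ker tau : ltiC Delta *m expmx (tau *: ltiA Delta) *m ltiB Delta =
    ((c *m expmx (tau *: a) *m b) 0 0)%:M.
  apply/matrixP => i' j'; rewrite [RHS]mxE !mul_expmxE.
  have -> : exp_coef (ltiC Delta) (ltiA Delta) (ltiB Delta) i' j' =
      (fun l => exp_coef c a b 0 0 l *+ (i' == j')).
    by apply/funext => l; rewrite /exp_coef mk mxE; case: (_ == _); rewrite ?mulr1n ?mulr0n ?mul0r.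
  case: (i' == j'); first by congr (limn (pseries _ _)); apply/funext.
  rewrite (_ : pseries _ _ = (fun=> 0)); first exact: lim_cst.
  by apply/funext => l; rewrite /pseries /series /= big1 // => x _; rewrite mulr0n mul0r.
rewrite /io_map DE mul_scalar_mx [LHS]mxE; congr (_ + _); last by rewrite mxE.
rewrite mxE; apply: eq_Rintegral => s _; rewrite ker mul_scalar_mx.
by rewrite [_ *m b]mx11_scalar mul_scalar_mx !mxE.
Qed.

Lemma lsubmx_mul m n p q (A : 'M[R]_(m, n)) (X : 'M[R]_(n, p + q)) :
  lsubmx (A *m X) = A *m lsubmx X.
Proof. by rewrite -{1}[X]hsubmxK mul_mx_row row_mxKl. Qed.

Lemma rsubmx_mul m n p q (A : 'M[R]_(m, n)) (X : 'M[R]_(n, p + q)) :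
  rsubmx (A *m X) = A *m rsubmx X.
Proof. by rewrite -{1}[X]hsubmxK mul_mx_row row_mxKr. Qed.

(** Xi is the state of the scalar system driven by all entries of (x1, z), with
    Th and X its blocks for x1 and for z.  If Th is filtered as x1 is, that is
    Th' = Th A^T + X B^T, then c Th + D0 x1^T solves the equation of x2, and
    uniqueness concludes.  To see the former, let e be the difference of the two
    expressions for Th': it solves e' = a e with e 0 = 0. *)
Lemma filters_commute N n k (a : 'M[R]_N) (b : 'cV[R]_N) (c : 'rV[R]_N) (D0 : R)
    (A : 'M[R]_n) (B : 'M[R]_(n, k)) (Xi : R -> 'M[R]_(N, n + k))
    (x1 x2 : R -> 'cV[R]_n) (z w : R -> 'cV[R]_k) :
  mprimitive Xi (fun t => a *m Xi t + b *m (col_mx (x1 t) (z t))^T) -> Xi 0 = 0 ->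
  mprimitive x1 (fun t => A *m x1 t + B *m z t) -> x1 0 = 0 ->
  mprimitive x2 (fun t => A *m x2 t + B *m w t) -> x2 0 = 0 ->
  (forall t, 0 <= t -> (w t)^T = c *m rsubmx (Xi t) + D0 *: (z t)^T) ->
  forall t, 0 <= t -> (x2 t)^T = c *m lsubmx (Xi t) + D0 *: (x1 t)^T.
Proof.
move=> hXi Xi0 hx1 x10 hx2 x20 wE.
pose Th t := lsubmx (Xi t); pose X t := rsubmx (Xi t).
have hTh : mprimitive Th (fun t => a *m Th t + b *m (x1 t)^T).
  apply: mprimitive_ext (mprimitive_lsubmx hXi) _ _ => // t _.
  by rewrite raddfD /= !lsubmx_mul tr_col_mx row_mxKl.
have hX : mprimitive X (fun t => a *m X t + b *m (z t)^T).
  apply: mprimitive_ext (mprimitive_rsubmx hXi) _ _ => // t _.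
  by rewrite raddfD /= !rsubmx_mul tr_col_mx row_mxKr.
pose e t := a *m Th t + b *m (x1 t)^T - (Th t *m A^T + X t *m B^T).
have e0 t : 0 <= t -> e t = 0.
  apply: (@linear_ode_unique _ _ _ a).
    have h1 := mprimitiveD (mprimitiveMl a hTh) (mprimitiveMl b (mprimitiveT hx1)).
    have h2 := mprimitiveD (mprimitiveMr A^T hTh) (mprimitiveMr B^T hX).
    apply: mprimitive_ext (mprimitiveB h1 h2) _ _ => // s _.
    rewrite /e !linearD /= !trmx_mul !(mulmxDl, mulmxDr) mulmxN !mulmxA.
    rewrite mulmxN mulmxA -!opprD -(addrA _ (_ + _) (- _)); congr (_ + _).
    by apply/eqP; rewrite subr_eq (addrACA (a *m Th s *m A^T)) addKr.
  by rewrite /e /Th /X Xi0 x10 trmx0 !(raddf0, mulmx0, mul0mx) subrr.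
pose eta t := (c *m Th t + D0 *: (x1 t)^T)^T.
have heta : mprimitive eta (fun t => A *m eta t + B *m w t).
  have hD := mprimitiveMl c hTh.
  have hE : mprimitive (fun t => D0 *: (x1 t)^T) (fun t => D0 *: (A *m x1 t + B *m z t)^T).
    apply: mprimitive_ext (mprimitiveMr D0%:M (mprimitiveT hx1)) _ _ => t _; exact: mul_mx_scalar.
  apply: mprimitive_ext (mprimitiveT (mprimitiveD hD hE)) _ _ => // t t0.
  have -> : a *m Th t + b *m (x1 t)^T = Th t *m A^T + X t *m B^T by apply/eqP; rewrite -subr_eq0; exact/eqP/e0.
  apply: trmx_inj; rewrite trmxK [RHS]linearD /= !trmx_mul trmxK wE // [(_ + _)^T]linearD /= !trmx_mul.
  rewrite scalerDr !mulmxDr !mulmxDl !mulmxA -!scalemxAl.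
  by rewrite addrACA.
move=> t t0; suff : x2 t - eta t = 0.
  by move/eqP; rewrite subr_eq0 => /eqP ->; rewrite trmxK.
apply: (@linear_ode_unique _ _ _ A (fun t => x2 t - eta t)) => //.
  apply: mprimitive_ext (mprimitiveB hx2 heta) _ _ => // s _.
  by rewrite opprD addrACA subrr addr0 mulmxBr.
by rewrite /eta /Th Xi0 x10 x20 trmx0 raddf0 mulmx0 scaler0 addr0 trmx0 subrr.
Qed.

End FilterCommutation.

(** * The dissipation inequality *)
Section Dissipation.
Variable R : realType.
Local Notation mu := (@lebesgue_measure R).

Lemma primitive_quadratic n (Z : 'M[R]_n) (x x' : R -> 'cV[R]_n) : mprimitive x x' ->
  primitive (fun t => ((x t)^T *m Z *m x t) 0 0)
    (fun t => ((x' t)^T *m Z *m x t + (x t)^T *m Z *m x' t) 0 0).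
Proof. by move=> hx; exact: mprimitiveM (mprimitiveMr Z (mprimitiveT hx)) hx 0 0. Qed.

Lemma primitive_storage N p (S : 'M[R]_N) (Q : 'M[R]_p) (X X' : R -> 'M[R]_(N, p)) :
  mprimitive X X' ->
  primitive (fun t => \tr (S *m X t *m Q *m (X t)^T))
    (fun t => \tr (S *m X' t *m Q *m (X t)^T) + \tr (S *m X t *m Q *m (X' t)^T)).
Proof.
move=> hX; have h := mprimitiveM (mprimitiveMr Q (mprimitiveMl S hX)) (mprimitiveT hX).
apply: primitive_ext (primitive_sum (fun i => h i i)) _ _ => t _ //.
by rewrite -mxtraceD.
Qed.

Lemma dissipation (sigma W w V v : R -> R) : prefix_integrable sigma ->
  primitive W w -> W 0 = 0 -> primitive V v -> V 0 = 0 ->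
  (forall t, 0 <= t -> v t <= sigma t + w t) ->
  forall T, 0 <= T -> 0 <= V T -> 0 <= \int[mu]_(t in `[0, T]) sigma t + W T.
Proof.
move=> hs [hw WE] W0 [hv VE] V0 le_v T T0.
rewrite (VE _ T0) (WE _ T0) V0 W0 !add0r => /le_trans -> //.
rewrite -RintegralD //; [|exact: hs|exact: hw].
apply: le_Rintegral => //; first exact: hv.
  exact: prefix_integrableD hs hw T T0.
by move=> t; rewrite /= in_itv /= => /andP[t0 _]; exact: le_v.
Qed.

End Dissipation.

Theorem theorem5 (R : realType) (k npsi mpsi : nat) (q s r : R) (hr : r <= 0)
  (psi : 'M[{fraction {poly R}}]_(mpsi, k)) (psi_RHinf : RHinf psi)
  (Apsi : 'M[R]_npsi) (Bpsi : 'M[R]_(npsi, k))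
  (Cpsi : 'M[R]_(mpsi, npsi)) (Dpsi : 'M[R]_(mpsi, k))
  (psiE : psi = transfer (Lti Apsi Bpsi Cpsi Dpsi))
  (Apsi_hurwitz : hurwitz Apsi)
  (Y : 'M[R]_npsi) (Y_sym : Y \is symmetricmx)
  (M : 'M[R]_mpsi) (M_sym : M \is symmetricmx)
  (LMI : posdefmx
     ((block_mx 1%:M 0 Apsi Bpsi)^T *m block_mx 0 Y Y 0
        *m block_mx 1%:M 0 Apsi Bpsi
      + (row_mx Cpsi Dpsi)^T *m M *m row_mx Cpsi Dpsi))
  (nD : nat) (Delta : lti R nD k k) :
  let P0 := mx22 q s r in
  let Psi := diag2 psi in
  Deltas (Vset P0 k) Delta ->
  finite_horizon_IQC Delta (lti_diag2 (Lti Apsi Bpsi Cpsi Dpsi)) Psi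
    (kron2 P0 M) (kron2 P0 Y)
    (para_conj Psi *m const_rmx (kron2 P0 M) *m Psi).
Proof.
move=> P0 Psi [DH DV]; split; [split| | | |] => //.
- exact: RHinf_diag2.
- by rewrite transfer_diag2 -psiE.
- exact: kron2_sym.
- exact: kron2_sym.
move=> z L2z u xi xi_state y T T0.
have [N [d [n [[dN sd] sn d_lt supply_ge0 GE]]]] := scalar_uncertainty hr DH DV.
have [DE markov] := scalar_impulse_response dN sd sn GE.
have [h1 [h2 [S storage]]] := storage_function dN sd sn hr d_lt supply_ge0.
set Q := (_ + _) in LMI; have {LMI} Qpsd := posdefmx_bilin_ge0 LMI.
have [diss V_ge0] := storage _ Q.
set a := companion_mx N d in diss markov; set b := companion_in R N in diss markov.
set c := coef_row N n *m jet_lift N d in markov.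
have sz := L2e_square_integrable L2z.
have sxi := continuous_square_integrable xi_state.1.
pose x1 t := usubmx (xi t); pose x2 t := dsubmx (xi t).
have xiE t : xi t = col_mx (x1 t) (x2 t) by rewrite vsubmxK.
have sx1 : square_integrable_mx x1.
  by move=> i j; move: (sxi (lshift _ i) j); apply: square_integrable_ext => t _; rewrite mxE.
have sx2 : square_integrable_mx x2.
  by move=> i j; move: (sxi (rshift _ i) j); apply: square_integrable_ext => t _; rewrite mxE.
pose f1 t := (col_mx (x1 t) (z t))^T.
have sf1 : square_integrable_mx f1 by exact/square_integrable_mxT/square_integrable_mx_col.
have [|X [hX X0 XE]] := @linear_ode_solution R _ _ a (fun t => b *m f1 t).
  by move=> i j; exact: square_integrable_integrable (square_integrable_mxMl b sf1 i j).
pose w := io_map Delta z.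
(* X is the state of delta driven by f1; its z-part produces the response w. *)
have wE t : 0 <= t -> (w t)^T = c *m rsubmx (X t) + n`_N *: (z t)^T.
  move=> t0; apply/matrixP => i j; rewrite ord1 [LHS]mxE (io_map_scalar DE markov).
  rewrite -rsubmx_mul [RHS]mxE [rsubmx _ _ _]mxE XE //; congr (_ + _); last by rewrite !mxE.
  apply: eq_Rintegral => x _; rewrite !mulmxA.
  by rewrite -[f1 x]hsubmxK !mul_mx_row row_mxEr /f1 tr_col_mx row_mxKr.
have sX := mprimitive_square_integrable hX.
have sw : square_integrable_mx w.
  have h := square_integrable_mxD (square_integrable_mxMl c (mprimitive_square_integrable
    (mprimitive_rsubmx hX))) (square_integrable_mxMl (n`_N)%:M (square_integrable_mxT sz)).
  apply: square_integrable_mx_ext (square_integrable_mxT h) => t t0.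
  by apply: trmx_inj; rewrite trmxK wE // mul_scalar_mx.
have su : square_integrable_mx u by exact: square_integrable_mx_col.
have [hxi xi0] := filter_state_primitive su xi_state.
have xi'E t : ltiA (lti_diag2 (Lti Apsi Bpsi Cpsi Dpsi)) *m xi t
    + ltiB (lti_diag2 (Lti Apsi Bpsi Cpsi Dpsi)) *m u t
    = col_mx (Apsi *m x1 t + Bpsi *m z t) (Apsi *m x2 t + Bpsi *m w t).
  by rewrite /= xiE !diag2_col add_col_mx.
have hx1 : mprimitive x1 (fun t => Apsi *m x1 t + Bpsi *m z t).
  by apply: mprimitive_ext (mprimitive_usubmx hxi) _ _ => // t _; rewrite xi'E col_mxKu.
have hx2 : mprimitive x2 (fun t => Apsi *m x2 t + Bpsi *m w t).
  by apply: mprimitive_ext (mprimitive_dsubmx hxi) _ _ => // t _; rewrite xi'E col_mxKd.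
have x10 : x1 0 = 0 by rewrite /x1 xi0 raddf0.
have x20 : x2 0 = 0 by rewrite /x2 xi0 raddf0.
pose f2 t := (col_mx (x2 t) (w t))^T.
pose J t := jet_lift N d *m X t + jet_top R N *m f1 t.
(* J is the jet belonging to the state X and the input f1, so that f2 is the
   response of delta to f1. *)
have f2E t : 0 <= t -> f2 t = coef_row N n *m J t.
  move=> t0; have x2E := filters_commute hX X0 hx1 x10 hx2 x20 wE t0.
  rewrite mulmxDr !mulmxA -/c coef_row_top.
  rewrite /f2 tr_col_mx x2E wE // mul_scalar_mx /f1 tr_col_mx scale_row_mx -add_row_mx.
  by rewrite -mul_mx_row hsubmxK.
(* The derivative of the storage is at most the integrand plus the
   derivative of the terminal cost. *)
apply: (@dissipation R (fun t => ((y t)^T *m kron2 P0 M *m y t) 0 0)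
  (fun t => ((xi t)^T *m kron2 P0 Y *m xi t) 0 0) _
  (fun t => \tr (S *m X t *m Q *m (X t)^T)) _ _ (primitive_quadratic (kron2 P0 Y) hxi) _
  (primitive_storage S Q hX) _ _ T T0 (V_ge0 Qpsd (X T))).
- have sy : square_integrable_mx y.
    by apply: square_integrable_mxD; apply: square_integrable_mxMl.
  have h := square_integrable_mxM (square_integrable_mxT sy) (square_integrable_mxMl (kron2 P0 M) sy) 0 0.
  by move: h; apply: prefix_integrable_ext => t _; rewrite mulmxA.
- by rewrite xi0 mulmx0 mxE.
- by rewrite X0 mulmx0 !mul0mx mxtrace0.
- move=> t t0.
  have := supply_form q s r Apsi Bpsi Cpsi Dpsi Y M (x1 t) (x2 t) (z t) (w t).
  rewrite /= -!xiE -/(f1 t) -/(f2 t) -/(lmi_mx _ _ _ _ _ _) f2E // => ->.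
  have /= -> := diss (X t) (f1 t); rewrite -/(J t).
  have := Qpsd (h1 *m J t); have := Qpsd (h2 *m J t); lra.
Qed.
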